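(* Let $\sigma>1$ and $h\in L^1(\mathbb{R})$. Consider the non-negative averaging function $h(t)$, whose support is contained in $[-l,l]$, where $$l=\frac{1}{\pi}\arccos\left[\left(\frac{1}{2^{\sigma+1}}\right)^{1/3}\right].$$ Then $G_h(z)=\sum_{n\in\mathbb{Z}}(\beta_\sigma\star h)(n)\,z^{-n}$ has no roots on the unit circle $|z|=1$, where $\beta_\sigma$ is the symmetric fractional B-spline of order $\sigma$.
   Context: The Fourier transform convention is $\widehat{f}(\omega)=\int_{\mathbb{R}}f(t)e^{-i\omega t}\,dt$. For real $\sigma>-1$ the symmetric fractional B-spline $\beta_\sigma\in L^1(\mathbb{R})\cap L^2(\mathbb{R})$ is defined by $\widehat{\beta}_\sigma(\omega)=\left|\frac{\sin(\omega/2)}{\omega/2}\right|^{\sigma+1}$. Convolution is $(f\star h)(s)=\int_{-\infty}^{\infty}f(t)h(s-t)\,dt$. The averaging function $h$ models the characteristics of the device that acquires the local average samples $(f\star h)(n)$, $n\in\mathbb{Z}$, of a function $f$.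
   Formalization: The averaging function h is assumed not to be zero almost everywhere; for h = 0, which the statement literally allows, G_h vanishes identically and the claim fails. *)

(* Defs.v *)
From HB Require Import structures.
From mathcomp Require Import all_boot all_order all_algebra.
From mathcomp Require Import all_classical all_reals all_analysis.
From mathcomp Require Import complex.

Set Implicit Arguments.
Unset Strict Implicit.
Unset Printing Implicit Defensive.

Import Order.TTheory GRing.Theory Num.Theory.
Import numFieldNormedType.Exports.

Local Open Scope classical_set_scope.
Local Open Scope complex_scope.
Local Open Scope ring_scope.

(* A series indexed by all integers converges when its halves over n >= 0 and
   n < 0 both do. [limn] is total, so [bilateral_sum] is only meaningful
   together with [bilateral_cvg]. They are stated over an abstract [K] because
   the topology is attached to numFieldType, not to [R[i]] itself. *)
Definition bilateral_cvg (K : numFieldType) (a : int -> K) : Prop :=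
  cvgn (series (fun n : nat => a n%:Z)) /\
  cvgn (series (fun n : nat => a (- n.+1%:Z))).

Definition bilateral_sum (K : numFieldType) (a : int -> K) : K :=
  limn (series (fun n : nat => a n%:Z)) +
  limn (series (fun n : nat => a (- n.+1%:Z))).

Definition expi (R : realType) (x : R) : R[i] := cos x +i* sin x.

Definition Cintegral (R : realType) (F : R -> R[i]) : R[i] :=
  (\int[lebesgue_measure]_t complex.Re (F t)) +i*
  (\int[lebesgue_measure]_t complex.Im (F t)).

Definition fourier (R : realType) (f : R -> R) (w : R) : R[i] :=
  Cintegral (fun t => (f t)%:C * expi (- (w * t))).

(* The value at 0 is set by hand, since 0 / 0 = 0 in a fieldType. *)
Definition sinc (R : realType) (x : R) : R := if x == 0 then 1 else sin x / x.

(* The Fourier transform determines an L^1 function only up to a null set, so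
   the spline is given by a predicate satisfied by all its representatives;
   convolution does not depend on the chosen one. *)
Definition is_fractional_bspline (R : realType) (sigma : R) (beta : R -> R) :
    Prop :=
  [/\ beta \in Lfun (@lebesgue_measure R) 1,
      beta \in Lfun (@lebesgue_measure R) 2%:E &
      forall w : R, fourier beta w = (`|sinc (w / 2)| `^ (sigma + 1))%:C].

Definition convolution (R : realType) (f h : R -> R) (s : R) : R :=
  \int[lebesgue_measure]_t (f t * h (s - t)).

Definition Gterm (R : realType) (beta h : R -> R) (z : R[i]) (n : int) : R[i] :=
  (convolution beta h n%:~R)%:C * z ^ (- n).

Definition G (R : realType) (beta h : R -> R) (z : R[i]) : R[i] :=
  bilateral_sum (Gterm beta h z).

Definition support_radius (R : realType) (sigma : R) : R :=
  1 / pi * acos ((1 / 2 `^ (sigma + 1)) `^ (1 / 3)).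

(* Main.v *)
Require Import Defs.
From HB Require Import structures.
From mathcomp Require Import all_boot all_order all_algebra.
From mathcomp Require Import all_classical all_reals all_analysis.
From mathcomp Require Import complex.
From mathcomp Require Import measurable_realfun.
From mathcomp Require Import ring lra zify.

(* Write [beta_hat w = |sinc (w / 2)| ^ s] with [s = sigma + 1 > 2], and let
   [z = exp (i theta)] with [0 <= theta <= pi] (up to conjugation).  Then
   [Re G (z) = int h(-t) W(t) dt], where
   [W(t) = sum_n beta (t + n) cos (n theta)] and, by Poisson summation,
   [W(t) = sum_k beta_hat (theta + 2 pi k) cos ((theta + 2 pi k) t)] for almost
   every [t].  Let [l] be the support radius and [c = cos (pi l)], so that
   [c ^ 3 = 2 ^ - s].  For [|t| <= l], after division by [beta_hat theta], the
   terms [k = 0, -1] contribute at least [min (c, 2 c ^ 2)], because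
   [cos (theta t) + cos ((2 pi - theta) t) =
    2 cos (pi t) cos ((pi - theta) t) >= 2 c ^ 2], while all other terms
   together are at most [2 * 2 ^ - s = 2 c ^ 3] in absolute value.  Hence
   [W > 0] on the support of [h(-t)] and [Re G (z) > 0].

   Only the Fourier transform of beta is given.  An integrable function whose
   Fourier coefficients at the frequencies [2 pi k / L] all vanish has integral
   0 over every [L]-periodic union of arcs, since the indicator function of such
   a set is a bounded limit of polynomials in a cosine.  With Lebesgue
   differentiation this yields the Poisson formula ([L = 1]) and, letting [L] go
   to infinity, a sup bound for functions whose transform is
   [O (1 / (1 + w ^ 2))].  The latter, applied to [beta (t)] and to
   [beta (t) (2 - 2 cos (d t))] as [d] goes to 0, shows that
   [beta (t) = O (1 / (1 + t ^ 2))], because the second differences of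
   [beta_hat] are [O (d ^ 2 / (1 + w ^ 2))].  This decay makes all the series
   absolutely convergent. *)

Import Order.TTheory GRing.Theory Num.Theory.
Import numFieldNormedType.Exports.

Local Open Scope classical_set_scope.
Local Open Scope complex_scope.
Local Open Scope ring_scope.

(** * Integrable functions on the line *)

Section LebesgueIntegral.
Context {R : realType}.
Implicit Types (f g : R -> R) (c : R).
Local Notation mu := (@lebesgue_measure R).

Definition L1 f : Prop := mu.-integrable setT (EFin \o f).

Lemma ae_imply (P Q : R -> Prop) : (forall x, P x -> Q x) ->
  {ae mu, forall x, P x} -> {ae mu, forall x, Q x}.
Proof.
by move=> PQ; apply: negligibleS => x /= nQ /PQ.
Qed.

Lemma ae_imply2 (P Q S : R -> Prop) : (forall x, P x -> Q x -> S x) ->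
  {ae mu, forall x, P x} -> {ae mu, forall x, Q x} ->
  {ae mu, forall x, S x}.
Proof.
move=> PQS aP aQ; apply: (negligibleS _ (negligibleU aP aQ)) => x /= nS.
apply: contrapT => /not_orP[/contrapT Px /contrapT Qx]; apply: nS.
exact: PQS.
Qed.

Lemma L1_measurable f : L1 f -> measurable_fun setT f.
Proof. by move=> /integrableP[mf _]; exact/measurable_EFinP. Qed.

Lemma L1_le f g : measurable_fun setT f -> L1 g ->
  (forall x, `|f x| <= g x) -> L1 f.
Proof.
move=> mf ig fg; apply: (le_integrable _ _ _ ig) => //.
  exact/measurable_EFinP.
by move=> x _; rewrite /= lee_fin (le_trans (fg x)) ?ler_norm.
Qed.

Lemma L1D f g : L1 f -> L1 g -> L1 (fun x => f x + g x).
Proof.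
move=> lf lg; have := integrableD measurableT lf lg.
by apply: eq_integrable => // x _; rewrite /= EFinD.
Qed.

Lemma L1Z c f : L1 f -> L1 (fun x => c * f x).
Proof.
move=> lf; have := integrableZl measurableT c lf.
by apply: eq_integrable => // x _; rewrite /= EFinM.
Qed.

Lemma L1N f : L1 f -> L1 (fun x => - f x).
Proof.
by move=> /(L1Z (-1)); apply: eq_integrable => // x _; rewrite /= mulN1r.
Qed.

Lemma L1B f g : L1 f -> L1 g -> L1 (fun x => f x - g x).
Proof. by move=> lf /L1N; exact: L1D. Qed.

Lemma L1_norm f : L1 f -> L1 (fun x => `|f x|).
Proof. exact: integrable_norm. Qed.

Lemma L1Mb f (b : R -> R) c : L1 f -> measurable_fun setT b -> (forall x, `|b x| <= c) ->
  L1 (fun x => f x * b x).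
Proof.
move=> lf mb bc; apply: (L1_le _ (fun x => c * `|f x|)).
- exact: measurable_funM (L1_measurable _ lf) mb.
- exact/L1Z/L1_norm.
- by move=> x; rewrite normrM mulrC ler_wpM2r.
Qed.

Lemma L1_indic (A : set R) : measurable A -> (mu A < +oo)%E -> L1 \1_A.
Proof.
move=> mA Afin; apply/integrableP; split.
  by apply/measurable_EFinP; exact: measurable_indic.
under eq_integral do rewrite /= ger0_norm//.
by rewrite integral_indic// setIT.
Qed.

Lemma L1_sum (f_ : nat -> R -> R) n : (forall k, L1 (f_ k)) ->
  L1 (fun x => \sum_(0 <= k < n) f_ k x).
Proof.
move=> lf; elim: n => [|n IHn].
  under eq_fun do rewrite big_geq//.
  exact: integrable0.
under eq_fun do rewrite big_nat_recr//=.
exact: L1D.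
Qed.

Lemma L1_ext f g : f =1 g -> L1 f -> L1 g.
Proof. by move=> /funext ->. Qed.

Lemma Rintegral_ext f g : f =1 g -> \int[mu]_x f x = \int[mu]_x g x.
Proof. by move=> /funext ->. Qed.

Lemma Rintegral_ae f g : measurable_fun setT f -> measurable_fun setT g ->
  {ae mu, forall x, f x = g x} -> \int[mu]_x f x = \int[mu]_x g x.
Proof.
move=> mf mg fg; rewrite /Rintegral; congr fine; apply: ae_eq_integral => //.
- exact/measurable_EFinP.
- exact/measurable_EFinP.
- by move: fg; apply: ae_imply => x /= -> _.
Qed.

Lemma Rintegral_dominated (f_ : nat -> R -> R) f g :
  (forall n, measurable_fun setT (f_ n)) -> L1 g ->
  (forall n x, `|f_ n x| <= g x) -> (forall x, f_ ^~ x @ \oo --> f x) ->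
  L1 f /\ (fun n => \int[mu]_x f_ n x) @ \oo --> \int[mu]_x f x.
Proof.
move=> mf_ lg fg ff.
have mf : measurable_fun setT f.
  by apply: (@measurable_fun_cvg _ _ R setT f_) => // x _; exact: ff.
have [lf _ cv] : [/\ mu.-integrable setT (EFin \o f),
    [sequence (\int[mu]_x `|(EFin \o f_ n) x - (EFin \o f) x|)%E]_n @ \oo --> 0%E &
    [sequence (\int[mu]_x (EFin \o f_ n) x)%E]_n @ \oo -->
      (\int[mu]_x (EFin \o f) x)%E].
  apply: (@dominated_convergence _ _ _ mu setT measurableT
    (fun n => EFin \o f_ n) (EFin \o f) (EFin \o g)) => //.
  - by move=> n; move: (f_ n) (mf_ n) => u mu_; exact/measurable_EFinP.
  - exact/measurable_EFinP.
  - by apply: aeW => x _; apply: cvg_EFin; [exact: nearW|exact: ff].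
  - by apply: aeW => x n _; rewrite /= lee_fin.
split => //; apply: fine_cvg; rewrite fineK//.
exact: integrable_fin_num.
Qed.

(** All partial sums are dominated by the single integrable function [limn (series c) * g], so the
    exchange of sum and integral is an instance of dominated convergence. *)
Lemma Rintegral_series (f_ : nat -> R -> R) (c : nat -> R) g :
  (forall n, measurable_fun setT (f_ n)) -> L1 g -> cvgn (series c) ->
  (forall x, 0 <= g x) ->
  (forall n x, `|f_ n x| <= c n * g x) ->
  [/\ forall x, cvgn (series (f_ ^~ x)),
     L1 (fun x => limn (series (f_ ^~ x))) &
     series (fun n => \int[mu]_x f_ n x) @ \oo -->
       \int[mu]_x limn (series (f_ ^~ x))].
Proof.
move=> mf_ lg cc g0 fc.
have lf n : L1 (f_ n).
  by apply: (L1_le _ (fun x => c n * g x)) => //; exact: L1Z.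
have cv x : cvgn (series (f_ ^~ x)).
  apply: normed_cvg => /=.
  apply: (@series_le_cvg _ (fun n => `|f_ n x|) (fun n => g x * c n)).
  - by move=> n.
  - by move=> n; rewrite mulrC; exact: le_trans (normr_ge0 _) (fc n x).
  - by move=> n; rewrite mulrC; exact: fc.
  - exact: (is_cvg_seriesZ (k := g x) cc).
have c0 n x : 0 <= c n * g x by exact: le_trans (normr_ge0 _) (fc n x).
have bnd n x : `|series (f_ ^~ x) n| <= limn (series c) * g x.
  rewrite /series/= (le_trans (ler_norm_sum _ _ _))//.
  apply: (@le_trans _ _ (\sum_(0 <= k < n) c k * g x)).
    exact: ler_sum.
  (* The sign of [c] is not assumed. It is read off from [0 <= c k * g x] at points where [g x > 0],
     and makes the partial sums of [c] monotone; where [g x = 0] both sides are 0. *)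
  rewrite -mulr_suml; have [->|gx] := eqVneq (g x) 0; first by rewrite !mulr0.
  have {}gx : 0 < g x by rewrite lt_neqAle eq_sym gx g0.
  rewrite ler_wpM2r//; apply: (nondecreasing_cvgn_le _ cc n).
  apply: nondecreasing_series => k _ _.
  by have := c0 k x; rewrite pmulr_lge0.
have [li cvi] := Rintegral_dominated (fun n x => series (f_ ^~ x) n)
  (fun x => limn (series (f_ ^~ x))) (fun x => limn (series c) * g x)
  (fun n => measurable_sum _ (fun k => mf_ k)) (L1Z _ _ lg) bnd cv.
split => //; apply: cvg_trans cvi; apply: near_eq_cvg; apply: nearW => n /=.
rewrite /series/=; elim: n => [|n IHn].
  rewrite big_geq//; under Rintegral_ext do rewrite big_geq//.
  by rewrite Rintegral_cst// mul0r.
rewrite big_nat_recr//= -IHn; under Rintegral_ext do rewrite big_nat_recr//=.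
rewrite RintegralD//; [exact: L1_sum|exact: lf].
Qed.

(** Change of variables: the integral of [f \o phi] is that of [f] against the pushforward of [mu],
    which coincides with [mu]. It serves for translations and for the reflection. *)
Lemma Rintegral_measure_preserving f
    (phi : {mfun measurableTypeR R >-> measurableTypeR R}) :
  (forall A : set R, measurable A -> mu (phi @^-1` A) = mu A) ->
  L1 f -> L1 (f \o phi) /\ \int[mu]_x f (phi x) = \int[mu]_x f x.
Proof.
move=> muphi lf; have mf := L1_measurable _ lf.
have mphi : measurable_fun setT phi by [].
have mfphi : measurable_fun setT (f \o phi) by exact: measurableT_comp.
have li : L1 (f \o phi).
  apply/integrableP; split; first exact/measurable_EFinP.
  have /integrableP[_] := lf; apply: le_lt_trans.
  rewrite [leRHS](_ : _ = (\int[pushforward mu phi]_x `|(EFin \o f) x|)%E).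
    rewrite ge0_integral_pushforward//.
    by apply: measurableT_comp => //; exact/measurable_EFinP.
  by apply: eq_measure_integral => A mA _; exact/esym/muphi.
split => //; rewrite /Rintegral; congr fine.
transitivity (\int[pushforward mu phi]_x (EFin \o f) x)%E.
  by rewrite integral_pushforward//; exact/measurable_EFinP.
by apply: eq_measure_integral => A mA _; exact: muphi.
Qed.

(** The translated measure agrees with [mu] on half-open intervals, hence everywhere by uniqueness
    of Lebesgue measure. *)
Lemma Rintegral_shift f c : L1 f ->
  L1 (fun x => f (x + c)) /\ \int[mu]_x f (x + c) = \int[mu]_x f x.
Proof.
have mshift : @measurable_fun _ _ (measurableTypeR R) (measurableTypeR R) setT
    (fun x => x + c).
  by apply: measurable_funD.
pose phi : {mfun measurableTypeR R >-> measurableTypeR R} :=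
  HB.pack (fun x : measurableTypeR R => x + c : measurableTypeR R)
    (isMeasurableFun.Build _ _ _ _ _ mshift).
apply: (@Rintegral_measure_preserving f phi) => A mA; apply/esym.
apply: (@lebesgue_measure_unique R (pushforward mu phi)) => //.
move=> _ [[a b]] _ <-; rewrite /pushforward/=.
rewrite [X in _ = mu X](_ : _ = `]a - c, b - c]%classic); last first.
  by apply/seteqP; split=> x /=; rewrite !in_itv/= ltrBlDr lerBrDr.
rewrite !lebesgue_measure_itv/= !lte_fin ltrD2r.
by case: ifP => // _; rewrite -!EFinB; congr EFin; ring.
Qed.

Lemma Rintegral_opp f : L1 f ->
  L1 (fun x => f (- x)) /\ \int[mu]_x f (- x) = \int[mu]_x f x.
Proof.
have mopp : @measurable_fun _ _ (measurableTypeR R) (measurableTypeR R) setT -%R.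
  exact: oppr_measurable.
pose phi : {mfun measurableTypeR R >-> measurableTypeR R} :=
  HB.pack (-%R : measurableTypeR R -> measurableTypeR R)
    (isMeasurableFun.Build _ _ _ _ _ mopp).
apply: (@Rintegral_measure_preserving f phi) => A mA.
exact: lebesgue_measureN.
Qed.

Lemma Rintegral_reflect f c : L1 f ->
  L1 (fun x => f (c - x)) /\ \int[mu]_x f (c - x) = \int[mu]_x f x.
Proof.
move=> lf; have [lg <-] := Rintegral_shift f c lf.
have [lh <-] := Rintegral_opp _ lg.
by split; [apply: L1_ext lh|apply: Rintegral_ext] => x; rewrite addrC.
Qed.

(** Lebesgue differentiation. The absolute value stands outside the integral, so it is enough to
    know the signed integrals of [f] over small balls, which is what Fourier coefficients give
    access to. *)
Lemma ae_le_of_averages f (U : set R) (M : R) : L1 f ->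
  (forall x, U x -> exists2 e, 0 < e & forall r, 0 < r < e ->
     `|\int[mu]_t (f t * \1_(ball x r) t)| <= M * (2 * r)) ->
  {ae mu, forall x, U x -> `|f x| <= M}.
Proof.
move=> lf fM; have mf := L1_measurable _ lf.
have /lebesgue_differentiation : locally_integrable setT f.
  by apply: open_integrable_locally => //; exact: openT.
apply: ae_imply => x xpt /fM[e e0 xM]; apply/ler_addgt0Pr => d d0.
have /fine_cvgP[xfin /cvgr_lt/(_ _ d0) xd] := xpt.
near (0:R)^'+ => r.
have r0 : 0 < r by near: r; exact: nbhs_right_gt.
have re : r < e by near: r; exact: nbhs_right_lt.
have mB : measurable (ball x r : set R) by exact: measurable_ball.
have Bfin : (mu (ball x r) < +oo)%E by rewrite lebesgue_measure_ball ?ltW// ltry.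
have lB := L1_indic _ mB Bfin.
have mBi := L1_measurable _ lB.
have Bi1 t : `|\1_(ball x r) t : R| <= 1.
  by rewrite indicE normr_nat lern1 leq_b1.
have lfB : L1 (fun t => f t * \1_(ball x r) t) by exact: (L1Mb _ _ 1).
have lxB : L1 (fun t => f x * \1_(ball x r) t) by exact: L1Z.
have IB : \int[mu]_t (f x * \1_(ball x r) t) = f x * (2 * r).
  rewrite RintegralZl//; congr *%R.
  rewrite /Rintegral integral_indic// setIT.
  rewrite [X in fine X](_ : _ = (r *+ 2)%:E) /=.
    by rewrite mulr2n; ring.
  exact: lebesgue_measure_ball (ltW r0).
(* At a Lebesgue point the mean deviation [|f t - f x|] over the ball is below [d]; thus [f x]
   differs from the average of [f] by at most [d]. *)
have dr : \int[mu]_t `|f t * \1_(ball x r) t - f x * \1_(ball x r) t| <= d * (2 * r).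
  have dfin : davg f x r \is a fin_num by near: r.
  have dlt : fine (davg f x r) < d by near: r.
  have ldB : L1 (fun t => `|f t * \1_(ball x r) t - f x * \1_(ball x r) t|).
    exact/L1_norm/L1B.
  have ballE : (\int[mu]_(y in ball x r) `|(f y - f x)%:E|)%E =
      (\int[mu]_t `|f t * \1_(ball x r) t - f x * \1_(ball x r) t|)%:E.
    rewrite /Rintegral fineK; last exact: integrable_fin_num.
    rewrite [LHS]integral_mkcond; apply: eq_integral => t _.
    rewrite /patch -mulrBl indicE; case: ifP => _ /=; first by rewrite mulr1.
    by rewrite mulr0 normr0.
  have : (davg f x r < d%:E)%E by rewrite -(fineK dfin) lte_fin.
  rewrite /davg /iavg /= ballE (_ : lebesgue_measure _ = (r *+ 2)%:E); last first.
    exact: lebesgue_measure_ball (ltW r0).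
  have r2 : 0 < r *+ 2 by rewrite pmulrn_lgt0.
  rewrite inver (gt_eqF r2) -EFinM lte_fin mulrC ltr_pdivrMr//.
  by rewrite -(mulr_natl r 2) => /ltW.
have r20 : 0 < 2 * r by rewrite mulr_gt0.
rewrite -(ler_pM2r r20) -[X in _ * X <= _]ger0_norm ?(ltW r20)//.
rewrite -normrM -IB.
have -> : \int[mu]_t (f x * \1_(ball x r) t) =
    \int[mu]_t (f t * \1_(ball x r) t) -
    \int[mu]_t (f t * \1_(ball x r) t - f x * \1_(ball x r) t).
  by rewrite RintegralB//; ring.
rewrite (le_trans (ler_normB _ _))// mulrDl lerD//; first by apply: xM; rewrite r0.
apply: le_trans dr; apply: le_normr_Rintegral => //; exact: L1B.
Unshelve. all: by end_near. Qed.

End LebesgueIntegral.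

(** * Functions with vanishing Fourier coefficients *)

Section StepApproximation.
Context {R : realType}.
Implicit Types (x y : R) (n m : nat).

Lemma bernoulli_ineq x n : -1 <= x -> 1 + n%:R * x <= (1 + x) ^+ n.
Proof.
move=> x1; elim: n => [|n IHn]; first by rewrite mul0r addr0 expr0.
rewrite exprS; apply: (@le_trans _ _ ((1 + x) * (1 + n%:R * x))).
  have : 0 <= n%:R * x ^+ 2 by rewrite mulr_ge0// sqr_ge0.
  by rewrite -natr1; lra.
by rewrite ler_wpM2l//; lra.
Qed.

(** With [z] the square root of [y], Bernoulli's inequality for [1 / z = 1 + h] bounds [n * z ^ n]
    by [1 / h], and the remaining factor [z ^ n] tends to 0. *)
Lemma cvg_natr_mul_expr y : 0 <= y < 1 ->
  (fun n => n%:R * y ^+ n) @ \oo --> (0 : R).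
Proof.
move=> /andP[y0 y1]; have [->|yn0] := eqVneq y 0.
  rewrite -cvg_shiftS/=; under eq_fun do rewrite expr0n/= mulr0.
  exact: cvg_cst.
have {yn0}y0 : 0 < y by rewrite lt_neqAle eq_sym yn0.
set z := Num.sqrt y; have z0 : 0 < z by rewrite sqrtr_gt0.
have zy : z ^+ 2 = y by rewrite sqr_sqrtr// ltW.
have z1 : z < 1 by rewrite -sqrtr1 ltr_sqrt.
set h := z^-1 - 1; have h0 : 0 < h by rewrite subr_gt0 invf_gt1.
have nz n : n%:R * z ^+ n <= h^-1.
  rewrite -ler_pdivlMr ?exprn_gt0// -exprVn -[z^-1](subrK 1) -/h addrC.
  have := @bernoulli_ineq h n; rewrite -subr_le0 => /(_ ltac:(lra)) H.
  rewrite -(ler_pM2l h0) mulrA divff ?gt_eqF// mul1r.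
  by rewrite mulrC; lra.
apply: (@squeeze_cvgr _ _ _ _ (fun=> 0) (fun n => h^-1 * z ^+ n)).
- apply: nearW => n; rewrite mulr_ge0 ?exprn_ge0 ?(ltW y0)//=.
  rewrite -zy -exprM mulnC exprM expr2 mulrA.
  by apply: ler_wpM2r => //; rewrite exprn_ge0// (ltW z0).
- exact: cvg_cst.
- rewrite -(mulr0 h^-1); apply: cvgMr; apply: cvg_expr.
  by rewrite gtr0_norm.
Qed.

(* The classical approximation of a step function by the polynomials
   (1 - x^n)^m; the exponent m = n 2^n makes them converge also at 1/2. *)
Lemma cvg_step_polynomial x : 0 <= x <= 1 ->
  (fun n => (1 - x ^+ n) ^+ (n * 2 ^ n)) @ \oo --> ((x < 2^-1)%R%:R : R).
Proof.
move=> /andP[x0 x1].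
have xn0 n : 0 <= x ^+ n by rewrite exprn_ge0.
have xn1 n : x ^+ n <= 1 by rewrite exprn_ile1.
have mx n : (n * 2 ^ n)%:R * x ^+ n = n%:R * (2 * x) ^+ n.
  by rewrite natrM natrX exprMn mulrA.
case: ltP => xh.
  have y01 : 0 <= 2 * x < 1 by apply/andP; split; lra.
  (* With [m = n * 2 ^ n], Bernoulli's inequality bounds the polynomial below by
     [1 - m * x ^ n = 1 - n * (2 * x) ^ n], which tends to 1. *)
  apply: (@squeeze_cvgr _ _ _ _ (fun n => 1 - n%:R * (2 * x) ^+ n) (fun=> 1)).
  - apply: nearW => n; apply/andP; split.
      rewrite -mx -mulrN; apply: bernoulli_ineq.
      by rewrite lerN2.
    by rewrite exprn_ile1 ?subr_ge0// lerBlDr lerDl.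
  - rewrite -[X in _ --> X]subr0; apply: cvgB; first exact: cvg_cst.
    exact: cvg_natr_mul_expr.
  - exact: cvg_cst.
apply: (@squeeze_cvgr _ _ _ _ (fun=> 0) (@harmonic R)).
- apply: nearW => n; rewrite exprn_ge0 ?subr_ge0//=.
  rewrite -[leRHS]div1r ler_pdivlMr ?ltr0Sn//.
  (* The product of [(1 - x ^ n) ^ m] and [(1 + x ^ n) ^ m] is at most 1, while the second factor is
     at least [1 + n * (2 * x) ^ n >= n + 1] because [x >= 1 / 2]. *)
  apply: (@le_trans _ _ ((1 - x ^+ n) ^+ (n * 2 ^ n) *
    (1 + x ^+ n) ^+ (n * 2 ^ n))).
    rewrite ler_wpM2l ?exprn_ge0 ?subr_ge0//.
    apply: (le_trans _ (bernoulli_ineq _ _ _)); last by rewrite (le_trans _ (xn0 n)).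
    rewrite mx -natr1 addrC lerD2l ler_peMr// exprn_ege1//.
    by rewrite mulrC -ler_pdivrMr// mul1r.
  rewrite -exprMn -subr_sqr expr1n exprn_ile1//.
    by rewrite subr_ge0 exprn_ile1.
  by rewrite lerBlDr lerDl sqr_ge0.
- exact: cvg_cst.
- exact: cvg_harmonic.
Qed.

End StepApproximation.

(** * From vanishing coefficients to vanishing integrals over periodic arcs *)

Section VanishingCoefficients.
Context {R : realType}.
Implicit Types (D f g : R -> R) (om p q : R) (k n : nat).
Local Notation mu := (@lebesgue_measure R).

Lemma measurable_cos_affine (a b : R) :
  measurable_fun setT (fun t : R => cos (a * t + b)).
Proof.
apply: continuous_measurable_fun => t.
apply: continuous_comp; last exact: continuous_cos.
by apply: cvgD; [apply: cvgMr; exact: cvg_id|exact: cvg_cst].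
Qed.

Lemma L1_cos_affine f (a b : R) : L1 f -> L1 (fun t => f t * cos (a * t + b)).
Proof.
move=> lf; apply: (L1Mb _ _ 1) => //; first exact: measurable_cos_affine.
by move=> t; exact: cos_max.
Qed.

(** The free phase [p] covers cosine and sine coefficients at once, and [k = 0] with [p = 0] gives
    the integral of [D] itself. *)
Definition vanishing om D : Prop := L1 D /\
  forall k p, \int[mu]_t (D t * cos (k%:R * om * t + p)) = 0.

Lemma cosM (a b : R) : cos a * cos b = 2^-1 * (cos (a + b) + cos (a - b)).
Proof. by rewrite cosD cosB; field. Qed.

Lemma vanishingB om f g : vanishing om f -> vanishing om g ->
  vanishing om (fun t => f t - g t).
Proof.
move=> [lf vf] [lg vg]; split; first exact: L1B.
move=> k p; under Rintegral_ext do rewrite mulrBl.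
by rewrite RintegralB//; [rewrite vf vg subrr|exact: L1_cos_affine..].
Qed.

Lemma vanishingZ om c f : vanishing om f -> vanishing om (fun t => c * f t).
Proof.
move=> [lf vf]; split; first exact: L1Z.
move=> k p; under Rintegral_ext do rewrite -mulrA.
by rewrite RintegralZl//; [rewrite vf mulr0|exact: L1_cos_affine].
Qed.

(** The product formula for cosines moves the frequency index [k] to [k + 1] and [k - 1]. For
    [k = 0] the index -1 becomes 1 by parity, at the price of an opposite phase; hence the class is
    stable only because every phase is allowed. *)
Lemma vanishing_cos om f q : vanishing om f ->
  vanishing om (fun t => f t * cos (om * t + q)).
Proof.
move=> [lf vf]; split; first exact: L1_cos_affine.
move=> k p.
have E t : f t * cos (om * t + q) * cos (k%:R * om * t + p) =
    2^-1 * (f t * cos (k.+1%:R * om * t + (p + q))) +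
    2^-1 * (f t * cos (k%:R * om * t + p - (om * t + q))).
  rewrite -mulrA [cos _ * _]mulrC cosM.
  have -> : k.+1%:R * om * t + (p + q) = k%:R * om * t + p + (om * t + q).
    by rewrite -natr1; ring.
  by ring.
under Rintegral_ext do rewrite E.
have [a [b ab]] : exists k' p', forall t, cos (k%:R * om * t + p - (om * t + q)) =
    cos (k'%:R * om * t + p') :> R.
  case: k {E} => [|k].
    by exists 1%N, (q - p) => t; rewrite -cosN; congr cos; ring.
  by exists k, (p - q) => t; congr cos; rewrite -natr1; ring.
under Rintegral_ext do rewrite ab.
rewrite RintegralD//; [|apply: L1Z; exact: L1_cos_affine..].
by rewrite !RintegralZl ?vf ?mulr0 ?addr0//; exact: L1_cos_affine.
Qed.

Lemma vanishing_expr om f (x : R -> R) n :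
  (forall g, vanishing om g -> vanishing om (fun t => g t * x t)) ->
  vanishing om f -> vanishing om (fun t => f t * x t ^+ n).
Proof.
move=> xv vf; elim: n => [|n IHn].
  by under eq_fun do rewrite expr0 mulr1.
by under eq_fun do rewrite exprSr mulrA; exact: xv.
Qed.

(** The class of vanishing functions is stable under multiplication by polynomials in the cosine.
    The step polynomials converge boundedly to the indicator of the arc, and dominated convergence
    concludes. *)
Lemma vanishing_arc om D x0 c : vanishing om D -> -1 <= c <= 1 ->
  \int[mu]_t (D t * (c < cos (om * t - om * x0))%R%:R) = 0.
Proof.
move=> vD /andP[c1 c2].
(* Since the cosine minus [c] lies in [[-2, 2]], this affine rescaling takes values in [[0, 1]] and
   is below [1 / 2] exactly on the arc. *)
pose x t := 2^-1 - (cos (om * t - om * x0) - c) / 4.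
have x01 t : 0 <= x t <= 1.
  by have := cos_le1 (om * t - om * x0); have := cos_geN1 (om * t - om * x0);
    rewrite /x => ? ?; apply/andP; split; lra.
have xv g : vanishing om g -> vanishing om (fun t => g t * x t).
  move=> vg; have := vanishingB _ _ _ (vanishingZ _ (2^-1 + c / 4) _ vg)
    (vanishingZ _ 4^-1 _ (vanishing_cos _ _ (- (om * x0)) vg)).
  rewrite (_ : (fun t => _) = (fun t => g t * x t))//.
  by apply/funext => t; rewrite /x; ring.
pose u n t := (1 - x t ^+ n) ^+ (n * 2 ^ n).
have uv n : vanishing om (fun t => D t * u n t).
  apply: vanishing_expr vD => g vg.
  have := vanishingB _ _ _ vg (vanishing_expr _ _ _ n xv vg).
  rewrite (_ : (fun t => _) = (fun t => g t * (1 - x t ^+ n)))//.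
  by apply/funext => t; ring.
have ulim t : u ^~ t @ \oo --> ((c < cos (om * t - om * x0))%R%:R : R).
  have -> : (c < cos (om * t - om * x0)) = (x t < 2^-1).
    by rewrite /x; apply/idP/idP; lra.
  exact: cvg_step_polynomial.
have u01 n t : `|u n t| <= 1.
  have /andP[xt0 xt1] := x01 t.
  have xn1 : x t ^+ n <= 1 by rewrite exprn_ile1.
  have xn0 : 0 <= x t ^+ n by rewrite exprn_ge0.
  by rewrite ger0_norm ?exprn_ge0 ?exprn_ile1//; lra.
have [lD D0] := vD.
have [_ lim2] := Rintegral_dominated (fun n t => D t * u n t)
  (fun t => D t * (c < cos (om * t - om * x0))%R%:R) (fun t => `|D t|)
  (fun n => L1_measurable _ (uv n).1) (L1_norm _ lD)
  (fun n t => ltac:(by rewrite normrM ler_piMr))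
  (fun t => cvgMr (ulim t)).
apply/esym; apply: cvg_unique lim2 => //.
rewrite (_ : (fun n => _) = (fun=> 0)); first exact: cvg_cst.
apply/funext => n; have := (uv n).2 0%N 0.
by under Rintegral_ext do rewrite !mul0r addr0 cos0 mulr1.
Qed.

End VanishingCoefficients.

(** * Fourier series of a given period *)

Section FourierSeries.
Context {R : realType}.
Implicit Types (f : R -> R) (p q t x : R) (k n : nat).
Local Notation mu := (@lebesgue_measure R).

(** Telescoping majorants yield summability together with an explicit bound on the sum, so no closed
    form of a series is ever computed. *)
Lemma telescoping_series_bound (u a : nat -> R) :
  (forall k, `|u k| <= a k - a k.+1) -> (forall k, 0 <= a k) ->
  [/\ cvgn (series (fun k => `|u k|)), cvgn (series u) &
    `|limn (series u)| <= a 0%N].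
Proof.
move=> ua a0.
have bnd n : series (fun k => `|u k|) n <= a 0%N.
  rewrite /series/=; apply: (@le_trans _ _ (a 0%N - a n)); last first.
    by rewrite lerBlDr lerDl.
  elim: n => [|n IHn]; first by rewrite big_geq// subrr.
  by rewrite big_nat_recr//=; have := ua n; lra.
have cvu : cvgn (series (fun k => `|u k|)).
  apply: nondecreasing_is_cvgn; first by apply: nondecreasing_series.
  by exists (a 0%N) => _ [n _ <-].
split => //; first exact: normed_cvg.
rewrite (le_trans (lim_series_norm cvu))//.
by apply: limr_le => //; exact: nearW.
Qed.

Definition window (L : R) : R -> R := \1_`[- (L / 2), L / 2]%classic.

Lemma window_itv L t : window L t = (- (L / 2) <= t <= L / 2)%R%:R.
Proof. by rewrite /window indicE mem_setE in_itv. Qed.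

Lemma L1_window L : L1 (window L).
Proof.
apply: L1_indic => //; rewrite lebesgue_measure_itv/=.
by case: ifP => // _; rewrite -EFinB ltry.
Qed.

Context (L : R) (L0 : 0 < L).
Local Notation om := (2 * pi / L).

Lemma Rintegral_window : \int[mu]_t window L t = L.
Proof.
have LL : - (L / 2) < L / 2 by have := L0; lra.
rewrite /Rintegral /window integral_indic// setIT.
rewrite [X in fine X](_ : _ = L%:E)//.
rewrite [LHS]lebesgue_measure_itv/= lte_fin LL.
by rewrite -EFinB; congr EFin; field.
Qed.

Lemma Rintegral_window_cos_affine (a p : R) : a != 0 ->
  \int[mu]_t (window L t * cos (a * t + p)) =
  (sin (a * (L / 2) + p) - sin (a * - (L / 2) + p)) / a.
Proof.
move=> a0.
pose F t := sin (a * t + p) / a.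
have dF t : is_derive t 1 F (cos (a * t + p)).
  have -> : cos (a * t + p) = a^-1 *: (cos (a * t + p) * a).
    by rewrite /GRing.scale/= mulrCA mulVf ?mulr1.
  rewrite (_ : F = a^-1 \*: (sin \o (fun t => a * t + p))); last first.
    by apply/funext => u; rewrite /F/= mulrC.
  apply: is_deriveZ; apply: is_derive1_comp.
  rewrite -[X in is_derive _ _ _ X]addr0; apply: is_deriveD.
  by rewrite -[X in is_derive _ _ _ X]mulr1; exact: is_deriveZ.
have cF t : {for t, continuous F}.
  by apply/differentiable_continuous/derivable1_diffP; case: (dF t).
have LL : - (L / 2) < L / 2 by have := L0; lra.
have ccos : continuous (fun t => cos (a * t + p)).
  move=> t; apply: continuous_comp; last exact: continuous_cos.
  by apply: cvgD; [apply: cvgMr; exact: cvg_id|exact: cvg_cst].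
rewrite /Rintegral [X in fine X](_ : _ =
  (\int[mu]_(t in `[(- (L / 2))%R, (L / 2)%R]) (cos (a * t + p))%:E)%E); last first.
  rewrite [RHS]integral_mkcond; apply: eq_integral => t _.
  rewrite /patch /window indicE; case: ifP => _ /=; first by rewrite mul1r.
  by rewrite mul0r.
rewrite (@continuous_FTC2 _ _ F)//.
- by rewrite /= /F -mulrBl.
- exact: continuous_subspaceT.
- split.
  + by move=> t _; case: (dF t).
  + by apply: cvg_at_right_filter; exact: cF.
  + by apply: cvg_at_left_filter; exact: cF.
- by move=> t _; rewrite derive1E; case: (dF t).
Qed.

Lemma Rintegral_window_cos k p :
  \int[mu]_t (window L t * cos (k.+1%:R * om * t + p)) = 0.
Proof.
have pi0 := pi_gt0 R.
rewrite Rintegral_window_cos_affine ?mulf_neq0 ?invr_eq0 ?gt_eqF//.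
have -> : k.+1%:R * om * (L / 2) + p =
    k.+1%:R * om * - (L / 2) + p + (pi *+ 2) *+ k.+1.
  by rewrite -[(pi *+ 2) *+ _]mulr_natl -[pi *+ 2]mulr_natl; field; rewrite gt_eqF.
by rewrite (periodicn (@sinD2pi R)) subrr mul0r.
Qed.

(** Orthogonality over one period: the product formula gives the indices [k + 1 + j], never 0, and
    [k + 1 - j], which is 0 only on the diagonal. *)
Lemma Rintegral_window_cos_cos k j p q :
  \int[mu]_t (window L t * cos (k.+1%:R * om * t + q) *
    cos (j%:R * om * t + p)) = (k.+1 == j)%:R * (L / 2 * cos (p - q)).
Proof.
have lc (a b : R) := L1_cos_affine _ a b (L1_window L).
have E t : window L t * cos (k.+1%:R * om * t + q) * cos (j%:R * om * t + p) =
    2^-1 * (window L t * cos ((k + j).+1%:R * om * t + (q + p))) +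
    2^-1 * (window L t * cos ((k.+1%:R - j%:R) * om * t + (q - p))).
  rewrite -mulrA cosM.
  have -> : (k + j).+1%:R * om * t + (q + p) =
    k.+1%:R * om * t + q + (j%:R * om * t + p) by rewrite -addSn natrD; ring.
  have -> : (k.+1%:R - j%:R) * om * t + (q - p) =
    k.+1%:R * om * t + q - (j%:R * om * t + p) by ring.
  by ring.
under Rintegral_ext do rewrite E.
rewrite RintegralD//; [|exact/L1Z/lc..].
rewrite !RintegralZl//; [|exact: lc..].
rewrite Rintegral_window_cos mulr0 add0r.
case: (ltngtP k.+1 j) => kj.
- rewrite mul0r.
  have [d ->] : exists d, j = (d.+1 + k.+1)%N by exists (j - k.+1).-1; lia.
  under Rintegral_ext => t.
    rewrite -cosN (_ : - _ = d.+1%:R * om * t + (p - q)); last by rewrite natrD; ring.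
    over.
  by rewrite Rintegral_window_cos mulr0.
- rewrite mul0r.
  have [d ->] : exists d, k.+1 = (d.+1 + j)%N by exists (k.+1 - j).-1; lia.
  under Rintegral_ext => t.
    rewrite natrD addrK.
    over.
  by rewrite Rintegral_window_cos mulr0.
- rewrite -kj mul1r.
  under Rintegral_ext do rewrite subrr !mul0r add0r -cosN opprB mulrC.
  by rewrite RintegralZl//; [rewrite Rintegral_window; ring|exact: L1_window].
Qed.

(* Only one phase [q] is allowed for all the harmonics: [q = 0] gives cosine
   series and [q = - (pi / 2)] gives sine series. *)
Definition harmonic_sum (c0 : R) (c : nat -> R) q t : R :=
  L^-1 * (c0 + 2 * limn (series (fun k => c k * cos (k.+1%:R * om * t + q)))).

(** Termwise integration against a harmonic. The normalization of [harmonic_sum] by [L^-1] and [2]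
    compensates the squared norms [L] and [L / 2] of the harmonics. *)
Lemma window_harmonic_sum (c0 : R) (c : nat -> R) q :
  cvgn (series (fun k => `|c k|)) ->
  L1 (fun t => window L t * harmonic_sum c0 c q t) /\
  forall j p,
    \int[mu]_t (window L t * harmonic_sum c0 c q t * cos (j%:R * om * t + p)) =
    if j is j'.+1 then c j' * cos (p - q) else c0 * cos p.
Proof.
move=> cc.
pose f_ p j k t := c k * (window L t * cos (k.+1%:R * om * t + q) * cos (j%:R * om * t + p)).
have lcc p j k : L1 (fun t => window L t * cos (k.+1%:R * om * t + q) *
    cos (j%:R * om * t + p)).
  by do 2 apply: L1_cos_affine; exact: L1_window.
have lf p j k : L1 (f_ p j k) by exact: L1Z.
have bf p j k t : `|f_ p j k t| <= `|c k| * `|window L t|.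
  rewrite !normrM ler_wpM2l//.
  rewrite (@le_trans _ _ (`|window L t| * 1))//; last by rewrite mulr1.
  by rewrite -mulrA ler_wpM2l// mulr_ile1// cos_max.
have key p j := Rintegral_series (f_ p j) (fun k => `|c k|) (fun t => `|window L t|)
  (fun k => L1_measurable _ (lf p j k)) (L1_norm _ (L1_window L)) cc
  (fun t => normr_ge0 _) (bf p j).
have cvc t : cvgn (series (fun k => c k * cos (k.+1%:R * om * t + q))).
  apply: normed_cvg => /=; apply: series_le_cvg cc => k //=.
  by rewrite normrM ler_piMr// cos_max.
have limE p j t : limn (series ((f_ p j)^~ t)) =
    window L t * cos (j%:R * om * t + p) *
    limn (series (fun k => c k * cos (k.+1%:R * om * t + q))).
  have := lim_seriesZ (window L t * cos (j%:R * om * t + p)) (cvc t).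
  rewrite (_ : _ *: _ = (f_ p j)^~ t)//.
  apply/funext => k; rewrite /f_.
  transitivity (window L t * cos (j%:R * om * t + p) *
    (c k * cos (k.+1%:R * om * t + q))); first by [].
  by ring.
have hE p j t : window L t * harmonic_sum c0 c q t * cos (j%:R * om * t + p) =
    L^-1 * c0 * (window L t * cos (j%:R * om * t + p)) +
    L^-1 * 2 * limn (series ((f_ p j)^~ t)).
  by rewrite limE /harmonic_sum; ring.
have lw p j : L1 (fun t => window L t * cos (j%:R * om * t + p)).
  exact/L1_cos_affine/L1_window.
split.
  have [_ l1 _] := key 0 0%N.
  have := L1D _ _ (L1Z (L^-1 * c0) _ (lw 0 0%N)) (L1Z (L^-1 * 2) _ l1).
  by apply: L1_ext => t; rewrite -hE !mul0r addr0 cos0 mulr1.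
move=> j p; have [_ l1 lim1] := key p j.
under Rintegral_ext do rewrite hE.
rewrite RintegralD//; [|exact: L1Z..].
rewrite (RintegralZl _ measurableT (lw p j)) RintegralZl//.
pose v := if j is j'.+1 then c j' * (L / 2 * cos (p - q)) else 0.
have -> : \int[mu]_t limn (series ((f_ p j)^~ t)) = v.
  apply/esym; apply: cvg_unique lim1 => //.
  have fkE k : \int[mu]_t f_ p j k t = (k.+1 == j)%:R * (c k * (L / 2 * cos (p - q))).
    rewrite RintegralZl//; last exact: lcc.
    by rewrite Rintegral_window_cos_cos; ring.
  (* By orthogonality only the term with [k.+1 = j] is nonzero, so the partial sums are constant
     from index [j] on. *)
  apply: (cvg_near_cst v); exists j => // n /= jn.
  rewrite /series/=; under eq_bigr do rewrite fkE.
  case: j jn {fkE l1} @v => [|j] jn v.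
    by rewrite big1// => k _; rewrite mul0r.
  rewrite (bigD1_seq j) ?mem_index_iota ?iota_uniq//= eqxx mul1r big1 ?addr0//.
  by move=> k kj; rewrite eqSS (negbTE kj) mul0r.
rewrite /v; case: j {key lim1 l1 v} => [|j].
  under Rintegral_ext do rewrite !mul0r add0r mulrC.
  rewrite RintegralZl//; last exact: L1_window.
  by rewrite Rintegral_window mulr0 addr0; field; rewrite gt_eqF.
by rewrite Rintegral_window_cos mulr0 add0r; field; rewrite gt_eqF.
Qed.

(** The condition [|x| + r < L / 2] keeps the ball inside one period, so that no other branch of the
    periodic arc enters the window. *)
Lemma arc_ballE x r t : 0 < r -> `|x| + r < L / 2 -> `|t| <= L / 2 ->
  (cos (om * r) < cos (om * t - om * x)) = (`|x - t| < r).
Proof.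
move=> r0 xr tL.
have pi0 := pi_gt0 R.
have om0 : 0 < om by rewrite divr_gt0// mulr_gt0.
have omL : om * L = 2 * pi by field; rewrite gt_eqF.
have xt : `|x - t| <= `|x| + `|t| by exact: ler_normB.
have x0 := normr_ge0 x; have xt0 := normr_ge0 (x - t).
have -> : cos (om * t - om * x) = cos (om * `|x - t|).
  by rewrite -mulrBr -cos_norm normrM gtr0_norm// distrC.
have rpi : om * r < pi.
  have : om * (2 * r) < om * L by rewrite ltr_pM2l//; lra.
  by rewrite omL; lra.
have or0 : 0 < om * r by exact: mulr_gt0.
have [vpi|vpi] := leP (om * `|x - t|) pi.
  have v0 : 0 <= om * `|x - t| by rewrite mulr_ge0// ltW.
  rewrite ltr_cos; [|by rewrite in_itv/=; apply/andP; split; lra..].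
  by rewrite ltr_pM2l.
(* Past the half period, the angle is reflected to [2 * pi] minus itself. As [|x - t| < L - r], the
   reflected angle still exceeds [om * r], and both sides are false. *)
have vlt : om * `|x - t| < 2 * pi - om * r.
  have : om * `|x - t| < om * (L - r) by rewrite ltr_pM2l//; lra.
  by rewrite mulrBr omL.
have -> : cos (om * `|x - t|) = cos (2 * pi - om * `|x - t|).
  have -> : 2 * pi - om * `|x - t| = - (om * `|x - t|) + pi *+ 2.
    by rewrite -mulr_natl; ring.
  by rewrite cosD2pi cosN.
rewrite ltr_cos; [|by rewrite in_itv/=; apply/andP; split; lra..].
transitivity false; first by apply/negbTE; rewrite -leNgt; lra.
apply/esym/negbTE; rewrite -leNgt -(ler_pM2l om0); lra.
Qed.

Lemma measurable_bool_indicator (P : R -> bool) : measurable_fun setT P ->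
  measurable_fun setT (fun t => (P t)%:R : R).
Proof.
move=> mP; have -> : (fun t => (P t)%:R : R) = \1_[set t | P t].
  by apply/funext => t; rewrite indicE; congr (nat_of_bool _)%:R;
    apply/idP/idP; rewrite inE.
apply: measurable_indic; rewrite -[X in measurable X]setTI.
rewrite (_ : [set t | _] = P @^-1` [set true])//.
exact: mP.
Qed.

Lemma measurable_arc (a b d : R) :
  measurable_fun setT (fun t => (d < cos (a * t - b))%R%:R : R).
Proof.
apply: measurable_bool_indicator.
exact: (measurable_fun_ltr (measurable_cst d) (measurable_cos_affine a (- b))).
Qed.

(** [f] and one period of its Fourier series have the same coefficients, so their difference is
    [vanishing] and they have equal integrals over the periodic arc. On the window the arc is a
    ball; for [f] itself all its periodic copies count. *)
Lemma Rintegral_arc f (c0 : R) (c : nat -> R) q x r :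
  L1 f -> cvgn (series (fun k => `|c k|)) ->
  \int[mu]_t f t = c0 ->
  (forall k p, \int[mu]_t (f t * cos (k.+1%:R * om * t + p)) = c k * cos (p - q)) ->
  0 < r -> `|x| + r < L / 2 ->
  \int[mu]_t (f t * (cos (om * r) < cos (om * t - om * x))%R%:R) =
  \int[mu]_t (harmonic_sum c0 c q t * \1_(ball x r) t).
Proof.
move=> lf cc fc0 fc r0 xr.
have [lS Sc] := window_harmonic_sum c0 c q cc.
have lfc p j : L1 (fun t => f t * cos (j%:R * om * t + p)) by exact: L1_cos_affine.
have vD : vanishing om (fun t => f t - window L t * harmonic_sum c0 c q t).
  split; first exact: L1B.
  move=> j p; under Rintegral_ext do rewrite mulrBl.
  rewrite RintegralB; [|by []|exact: lfc|exact: L1_cos_affine].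
  rewrite Sc; case: j => [|j]; last by rewrite fc subrr.
  under Rintegral_ext do rewrite !mul0r add0r mulrC.
  by rewrite RintegralZl// fc0 mulrC subrr.
have := vanishing_arc _ _ x (cos (om * r)) vD _.
rewrite cos_geN1 cos_le1 => /(_ isT).
have marc := measurable_arc om (om * x) (cos (om * r)).
have arc1 t : `|(cos (om * r) < cos (om * t - om * x))%R%:R : R| <= 1.
  by case: (_ < _); rewrite ?normr1 ?normr0.
under Rintegral_ext do rewrite mulrBl.
rewrite RintegralB//; [|exact: (L1Mb _ _ 1)..].
move/eqP; rewrite subr_eq0 => /eqP ->; apply: Rintegral_ext => t.
rewrite window_itv; have [tL|tL] := boolP (- (L / 2) <= t <= L / 2); last first.
  rewrite !mul0r indicE memNset ?mulr0//= /ball/= => xt; move/negP: tL; apply.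
  have := ler_norm (x - t); have := ler_norm (t - x); rewrite distrC.
  have := ler_norm x; have := ler_norm (- x); rewrite normrN => h1 h2 h3 h4.
  by apply/andP; split; lra.
rewrite mul1r arc_ballE//; last by rewrite ler_norml.
by rewrite indicE; congr (_ * (nat_of_bool _)%:R); apply/idP/idP; rewrite inE.
Qed.

End FourierSeries.

(** * Sup bound for functions whose transform decays quadratically *)

Section FourierBound.
Context {R : realType}.
Implicit Types (f : R -> R) (p q t x : R) (k n : nat).
Local Notation mu := (@lebesgue_measure R).

Lemma L1_ball x (r : R) : 0 <= r -> L1 (\1_(ball x r) : R -> R).
Proof.
move=> r0; apply: L1_indic; first exact: measurable_ball.
by rewrite lebesgue_measure_ball// ltry.
Qed.

Lemma Rintegral_ball x (r : R) : 0 <= r -> \int[mu]_t \1_(ball x r) t = 2 * r.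
Proof.
move=> r0; have mB : measurable (ball x r : set R) by exact: measurable_ball.
rewrite /Rintegral integral_indic// setIT.
rewrite [X in fine X](_ : _ = (r *+ 2)%:E) /=; first by rewrite mulr_natl.
exact: lebesgue_measure_ball r0.
Qed.

Lemma indic_norm_le1 (A : set R) t : `|\1_A t : R| <= 1.
Proof. by rewrite indicE normr_nat lern1 leq_b1. Qed.

Lemma norm_Rintegral_ball f x (r M : R) : 0 <= r ->
  L1 (fun t => f t * \1_(ball x r) t) -> (forall t, `|f t| <= M) ->
  `|\int[mu]_t (f t * \1_(ball x r) t)| <= M * (2 * r).
Proof.
move=> r0 lf fM; rewrite (le_trans (le_normr_Rintegral _ _))//.
rewrite -(Rintegral_ball x)// -RintegralZl//; last exact: L1_ball.
apply: le_Rintegral => //; [exact: L1_norm|exact/L1Z/L1_ball|].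
move=> t _; rewrite normrM [`|\1__ t|]ger0_norm; last by rewrite indicE ler0n.
by rewrite ler_wpM2r// indicE ler0n.
Qed.

Lemma harmonic_sum_bound (F : R -> R) (M L q t : R) : 1 <= L ->
  (forall w, `|F w| <= M / (1 + w ^+ 2)) ->
  let c k := F (k.+1%:R * (2 * pi / L)) in
  cvgn (series (fun k => `|c k|)) /\ `|harmonic_sum L (F 0) c q t| <= 5 * M.
Proof.
move=> L1 FM c.
have M0 : 0 <= M by have := FM 0; rewrite expr0n addr0 divr1; apply: le_trans.
have L0 : 0 < L by lra.
have Li : 0 <= L^-1 by rewrite invr_ge0 ltW.
(* The frequency is at least [(k + 1) / L], so the differences of [a] dominate the coefficients.
   With [a 0 = 2 * M * L], the total is at most [(M + 4 * M * L) / L <= 5 * M]. *)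
pose a k : R := 2 * M * L ^+ 2 / (L + k%:R).
have Lk k : 0 < L + k%:R by have := ler0n R k; lra.
have a0 k : 0 <= a k.
  by rewrite divr_ge0 ?(ltW (Lk k))// mulr_ge0 ?sqr_ge0// mulr_ge0.
have ca k : `|c k| <= a k - a k.+1.
  apply: le_trans (FM _) _.
  have -> : a k - a k.+1 = M * (2 * L ^+ 2 / ((L + k%:R) * (L + k.+1%:R))).
    have := Lk k; have := Lk k.+1; rewrite /a -natr1 => h1 h2.
    by field; apply/andP; split; rewrite gt_eqF.
  rewrite ler_wpM2l// ler_pdivlMr; last by rewrite mulr_gt0.
  set w := k.+1%:R * (2 * pi / L); have w2 : (k.+1%:R / L) ^+ 2 <= w ^+ 2.
    rewrite ler_sqr ?nnegrE ?divr_ge0 ?mulr_ge0 ?pi_ge0// ?(ltW L0)//.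
    rewrite /w [_ * (_ / L)]mulrA ler_wpM2r//.
    by rewrite ler_peMr//; have := pi_ge2 R; lra.
  have w0 : 0 < 1 + w ^+ 2 by have := sqr_ge0 w; lra.
  rewrite mulrC ler_pdivrMr//.
  apply: (@le_trans _ _ (2 * L ^+ 2 * (1 + (k.+1%:R / L) ^+ 2))); last first.
    by apply: ler_wpM2l; [rewrite mulr_ge0 ?sqr_ge0|rewrite lerD2l].
  have -> : 2 * L ^+ 2 * (1 + (k.+1%:R / L) ^+ 2) = 2 * (L ^+ 2 + k.+1%:R ^+ 2).
    by field; rewrite gt_eqF.
  have := sqr_ge0 (L - k.+1%:R); have := Lk k; rewrite -natr1.
  by have := ler0n R k; nra.
have [cv1 cv2 lim] := telescoping_series_bound _ _ ca a0; split => //.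
have ccos k : `|c k * cos (k.+1%:R * (2 * pi / L) * t + q)| <= a k - a k.+1.
  by apply: le_trans (ca k); rewrite normrM ler_piMr// cos_max.
have [_ _ lim2] := telescoping_series_bound _ _ ccos a0.
rewrite /harmonic_sum normrM gtr0_norm ?invr_gt0//.
rewrite ler_pdivrMl//.
have F0 := FM 0; rewrite expr0n addr0 divr1 in F0.
rewrite (le_trans (ler_normD _ _))// normrM ger0_norm//.
have a00 : a 0%N = 2 * M * L by rewrite /a; field; rewrite gt_eqF.
rewrite a00 in lim2.
by nra.
Qed.

(** For a period [n] tending to infinity, the integral of [f] over a ball is its integral over the
    periodic arc, controlled by the harmonic sum on the ball, up to the mass of [f] outside the
    window of length [n]. That mass tends to 0 and the bound on the harmonic sum does not depend on
    [n]. *)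
Lemma ae_bound_of_fourier f (F : R -> R) (M : R) : L1 f ->
  (forall w p, \int[mu]_t (f t * cos (w * t + p)) = F w * cos p) ->
  (forall w, `|F w| <= M / (1 + w ^+ 2)) ->
  {ae mu, forall t, `|f t| <= 5 * M}.
Proof.
move=> lf Ff FM.
suff : {ae mu, forall t, setT t -> `|f t| <= 5 * M}.
  by apply: ae_imply => t; exact.
apply: ae_le_of_averages => // x _; exists 1 => // r /andP[r0 _].
have lout n : L1 (fun t => f t * (1 - window n%:R t)).
  apply: (L1Mb _ _ 1) => //.
    by apply: measurable_funB => //; exact: (L1_measurable _ (L1_window _)).
  by move=> t; rewrite window_itv; case: (_ && _); rewrite ?subrr ?subr0 ?normr0 ?normr1.
have out0 : (fun n => \int[mu]_t `|f t * (1 - window n%:R t)|) @ \oo --> (0 : R).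
  have bnd n t : `| `|f t * (1 - window n%:R t)| | <= `|f t|.
    rewrite normr_id normrM ler_piMr//.
    by rewrite window_itv; case: (_ && _); rewrite ?subrr ?subr0 ?normr0 ?normr1.
  have lim0 t : (fun n => `|f t * (1 - window n%:R t)|) @ \oo --> (0 : R).
    apply: (cvg_near_cst 0); near=> n.
    have tn : 2 * `|t| <= n%:R by near: n; exact: nbhs_infty_ger.
    rewrite window_itv.
    have -> : - (n%:R / 2) <= t <= n%:R / 2 by rewrite -ler_norml; lra.
    by rewrite subrr mulr0 normr0.
  have [_] := Rintegral_dominated _ _ _
    (fun n => L1_measurable _ (L1_norm _ (lout n))) (L1_norm _ lf) bnd lim0.
  by rewrite Rintegral_cst// mul0r.
apply/ler_addgt0Pr => e e0.
have := cvgr_lt _ out0 _ e0 => near_e.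
near \oo => n.
have oute : \int[mu]_t `|f t * (1 - window n%:R t)| < e by near: n; exact: near_e.
have nbig : 2 * (`|x| + r) + 2 < n%:R by near: n; exact: nbhs_infty_gtr.
have n1 : 1 <= n%:R :> R by have := normr_ge0 x; lra.
have n0 : 0 < n%:R :> R by lra.
have xr : `|x| + r < n%:R / 2 by lra.
have [cc Sb] : cvgn (series (fun k => `|F (k.+1%:R * (2 * pi / n%:R))|)) /\
    forall t, `|harmonic_sum n%:R (F 0) (fun k => F (k.+1%:R * (2 * pi / n%:R))) 0 t| <= 5 * M.
  split=> [|t].
    by have [] := harmonic_sum_bound _ _ _ 0 0 n1 FM.
  by have [] := harmonic_sum_bound _ _ _ 0 t n1 FM.
have f0 : \int[mu]_t f t = F 0.
  have := Ff 0 0; rewrite cos0 mulr1 => <-.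
  by apply: Rintegral_ext => t; rewrite mul0r addr0 cos0 mulr1.
have arc := Rintegral_arc _ n0 _ _ _ 0 x r lf cc f0
  (fun k p => ltac:(by rewrite subr0)) r0 xr.
set om := 2 * pi / n%:R in arc.
have lB : L1 (fun t => f t * \1_(ball x r) t).
  apply: (L1Mb _ _ 1) => //; first exact: (L1_measurable _ (L1_ball _ _ (ltW r0))).
  exact: indic_norm_le1.
have lA : L1 (fun t => f t * (cos (om * r) < cos (om * t - om * x))%R%:R).
  apply: (L1Mb _ _ 1) => //; first exact: measurable_arc.
  by move=> t; rewrite normr_nat lern1 leq_b1.
have -> : \int[mu]_t (f t * \1_(ball x r) t) =
    \int[mu]_t (f t * (cos (om * r) < cos (om * t - om * x))%R%:R) +
    \int[mu]_t (f t * \1_(ball x r) t -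
      f t * (cos (om * r) < cos (om * t - om * x))%R%:R).
  by rewrite RintegralB//; ring.
rewrite (le_trans (ler_normD _ _))// lerD//.
  rewrite arc; apply: norm_Rintegral_ball => //; first exact: ltW.
  have [lS _] := window_harmonic_sum _ n0 (F 0) _ 0 cc.
  have mB := L1_measurable _ (L1_ball x r (ltW r0)).
  have := L1Mb _ _ 1 lS mB (indic_norm_le1 _).
  apply: L1_ext => t; rewrite window_itv indicE.
  have [/set_mem|] := boolP (t \in (ball x r : set R)); last by rewrite !mulr0.
  rewrite /ball/= => xt; rewrite (_ : - (n%:R / 2) <= t <= n%:R / 2) ?mul1r// -ler_norml.
  have := ler_normB x (x - t); rewrite opprB addrC subrK; lra.
apply: le_trans (ltW oute).
rewrite (le_trans (le_normr_Rintegral _ _))//; first exact: L1B.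
apply: le_Rintegral => //; [exact/L1_norm/L1B|exact: L1_norm|].
move=> t _; rewrite -mulrBr !normrM ler_wpM2l// window_itv indicE.
have [tn|tn] := boolP (- (n%:R / 2) <= t <= n%:R / 2).
  rewrite arc_ballE//; last by rewrite ler_norml.
  rewrite (_ : (t \in (ball x r : set R)) = (`|x - t| < r)) ?subrr ?normr0//.
  by apply/idP/idP; rewrite inE.
by case: (_ \in _); case: (_ < _);
  rewrite ?subrr ?subr0 ?sub0r ?normrN ?normr1 ?normr0.
Unshelve. all: by end_near. Qed.

End FourierBound.

(** * Second differences of the transform and decay of the spline *)

Section SincAndPowers.
Context {R : realType}.
Implicit Types (x y t d s : R).
Local Notation mu := (@lebesgue_measure R).

Lemma sin_norm_le x : `|sin x| <= `|x|.
Proof.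
wlog x0 : x / 0 <= x.
  move=> H; have [/H//|x0] := leP 0 x.
  by have := H (- x); rewrite sinN !normrN; apply; lra.
have [c _] := @MVT_segment R sin cos 0 x x0 (fun y _ => is_derive_sin y)
  (continuous_subspaceT (@continuous_sin R)).
rewrite sin0 !subr0 => ->; rewrite normrM.
by rewrite ler_piMl// cos_max.
Qed.

Lemma oneBcos_bounds y : 0 <= 1 - cos y <= y ^+ 2 / 2.
Proof.
have -> : 1 - cos y = 2 * sin (y / 2) ^+ 2.
  have := cos_mulr2n (y / 2); have := cos2Dsin2 (y / 2).
  rewrite -[(y / 2) *+ 2]mulr_natr divfK// => h1 ->; lra.
rewrite mulr_ge0 ?sqr_ge0//=.
have := sin_norm_le (y / 2); rewrite -ler_sqr ?nnegrE// !real_normK ?num_real//.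
by rewrite exprMn; lra.
Qed.

Lemma cos_lipschitz x y : `|cos x - cos y| <= `|x - y|.
Proof.
wlog xy : x y / y <= x.
  move=> H; have [/H//|/ltW/H] := leP y x.
  by rewrite distrC [`|y - x|]distrC.
have [c _ ->] := @MVT_segment R cos (fun t => - sin t) y x xy
  (fun z _ => is_derive_cos z) (continuous_subspaceT (@continuous_cos R)).
by rewrite normrM normrN ler_piMl// sin_max.
Qed.

Lemma mulr_sinc x : x * sinc x = sin x.
Proof.
rewrite /sinc; case: eqVneq => [->|x0]; first by rewrite mul0r sin0.
by rewrite mulrC divfK.
Qed.

(* Writing [sinc] as an average of cosines makes its finite differences at 0
   as easy to bound as those of [cos]. *)
Lemma sinc_integral x :
  sinc x = 2^-1 * \int[mu]_t (window 2 t * cos (x * t + 0)).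
Proof.
have [->|x0] := eqVneq x 0.
  under Rintegral_ext do rewrite mul0r add0r cos0 mulr1.
  by rewrite Rintegral_window// /sinc eqxx mulVf.
rewrite Rintegral_window_cos_affine// /sinc (negbTE x0) divff// mulrN !mulr1 !addr0.
by rewrite sinN; field.
Qed.

Lemma norm_window_integral_le (g : R -> R) (M : R) :
  measurable_fun setT g ->
  (forall t, -1 <= t <= 1 -> `|g t| <= M) ->
  `|\int[mu]_t (window 2 t * g t)| <= 2 * M.
Proof.
move=> mg gM.
have M0 : 0 <= M by apply: le_trans (gM 0 _); rewrite ?normr_ge0//; apply/andP; split; lra.
have bnd t : `|window 2 t * g t| <= M * window 2 t.
  rewrite window_itv divff//; have [tI|tI] := boolP (-1 <= t <= 1).
    by rewrite mul1r mulr1 gM.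
  by rewrite mul0r mulr0 normr0.
have lM : L1 (fun t => M * window 2 t) by exact/L1Z/L1_window.
have lg : L1 (fun t => window 2 t * g t).
  apply: L1_le lM bnd; apply: measurable_funM => //.
  exact: (L1_measurable _ (L1_window _)).
rewrite (le_trans (le_normr_Rintegral _ _))//.
rewrite (@le_trans _ _ (\int[mu]_t (M * window 2 t)))//.
  by apply: le_Rintegral => //; exact: L1_norm.
by rewrite RintegralZl//; [rewrite Rintegral_window// mulrC|exact: L1_window].
Qed.

Lemma L1_window_cos x : L1 (fun t => window 2 t * cos (x * t + 0)).
Proof. exact/L1_cos_affine/L1_window. Qed.

Lemma sinc_norm_le1 x : `|sinc x| <= 1.
Proof.
rewrite sinc_integral normrM ger0_norm ?invr_ge0//.
have := norm_window_integral_le _ 1 (measurable_cos_affine x 0)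
  (fun t _ => cos_max _); lra.
Qed.

Lemma sinc_ge x : 1 - x ^+ 2 / 2 <= sinc x.
Proof.
have -> : sinc x = 1 - 2^-1 * \int[mu]_t (window 2 t * (1 - cos (x * t + 0))).
  under Rintegral_ext do rewrite mulrBr mulr1.
  rewrite RintegralB//; [|exact: L1_window|exact: L1_window_cos].
  by rewrite sinc_integral Rintegral_window//; field.
have mg : measurable_fun setT (fun t => 1 - cos (x * t + 0)).
  by apply: measurable_funB => //; exact: measurable_cos_affine.
have /(_ (x ^+ 2 / 2)) := norm_window_integral_le _ _ mg.
rewrite ler_norml => H.
suff /H/andP[_] : forall t : R, -1 <= t <= 1 -> `|1 - cos (x * t + 0)| <= x ^+ 2 / 2.
  lra.
move=> t /andP[t1 t2]; have /andP[c0 c1] := oneBcos_bounds (x * t + 0).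
rewrite ger0_norm// (le_trans c1)// addr0 exprMn ler_pM2r ?invr_gt0//.
rewrite ler_piMr ?sqr_ge0// -real_normK ?num_real// exprn_ile1// ler_norml.
by rewrite t1.
Qed.

Lemma sinc_diff_le x d : `|sinc (x + d) - sinc x| <= `|d|.
Proof.
rewrite !sinc_integral -mulrBr -RintegralB//; [|exact: L1_window_cos..].
under Rintegral_ext do rewrite -mulrBr.
rewrite normrM ger0_norm ?invr_ge0//.
set g := fun t => cos ((x + d) * t + 0) - cos (x * t + 0).
have mg : measurable_fun setT g.
  by apply: measurable_funB; exact: measurable_cos_affine.
have /(_ `|d|) := norm_window_integral_le _ _ mg.
suff : forall t : R, -1 <= t <= 1 -> `|g t| <= `|d| by move=> h /(_ h); lra.
move=> t tI; rewrite (le_trans (cos_lipschitz _ _))//.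
have -> : (x + d) * t + 0 - (x * t + 0) = d * t by ring.
by rewrite normrM ler_piMr// ler_norml.
Qed.

Lemma sinc_diff2_le x d :
  `|sinc (x + d) + sinc (x - d) - 2 * sinc x| <= d ^+ 2.
Proof.
have E : sinc (x + d) + sinc (x - d) - 2 * sinc x =
    2^-1 * \int[mu]_t (window 2 t * (2 * cos (x * t + 0) * (cos (d * t) - 1))).
  have -> : (fun t => window 2 t * (2 * cos (x * t + 0) * (cos (d * t) - 1))) =
    (fun t => window 2 t * cos ((x + d) * t + 0) + window 2 t * cos ((x - d) * t + 0)
      - 2 * (window 2 t * cos (x * t + 0))).
    apply/funext => t; rewrite !addr0 [(x + d) * t]mulrDl [(x - d) * t]mulrBl.
    by rewrite cosD cosB; ring.
  rewrite RintegralB//; [|exact/L1D/L1_window_cos/L1_window_cos|exact/L1Z/L1_window_cos].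
  rewrite RintegralD//; [|exact: L1_window_cos..].
  rewrite RintegralZl//; last exact: L1_window_cos.
  by rewrite !sinc_integral; ring.
rewrite E normrM ger0_norm ?invr_ge0//.
set g := fun t => 2 * cos (x * t + 0) * (cos (d * t) - 1).
have mg : measurable_fun setT g.
  apply: measurable_funM.
    by apply: measurable_funM => //; exact: measurable_cos_affine.
  apply: measurable_funB => //; have := measurable_cos_affine d 0.
  by under eq_fun do rewrite addr0.
have /(_ (d ^+ 2)) := norm_window_integral_le _ _ mg.
suff : forall t : R, -1 <= t <= 1 -> `|g t| <= d ^+ 2 by move=> h /(_ h); lra.
move=> t /andP[t1 t2]; have /andP[c0 c1] := oneBcos_bounds (d * t).
rewrite /g !normrM ger0_norm// [`|cos _ - 1|]distrC [`|1 - _|]ger0_norm//.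
have t21 : t ^+ 2 <= 1.
  by rewrite -real_normK ?num_real// exprn_ile1// ler_norml t1.
have b1 : 1 - cos (d * t) <= d ^+ 2 / 2.
  rewrite (le_trans c1)// exprMn ler_pM2r ?invr_gt0//.
  by rewrite ler_piMr ?sqr_ge0.
have a1 := cos_max (x * t + 0); have a0 := normr_ge0 (cos (x * t + 0)).
by nra.
Qed.

(** Multiplication by [x] turns [sinc] into [sin] up to a term with a factor [d]. Together with the
    unweighted estimate this gives decay of the difference in [x]. *)
Lemma mul_sinc_diff_le x d : `|x * (sinc (x + d) - sinc x)| <= 2 * `|d|.
Proof.
have -> : x * (sinc (x + d) - sinc x) = (sin (x + d) - sin x) - d * sinc (x + d).
  by rewrite -!mulr_sinc; ring.
rewrite (le_trans (ler_normB _ _))//.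
have h1 : `|sin (x + d) - sin x| <= `|d|.
  rewrite -!cosBpihalf (le_trans (cos_lipschitz _ _))//.
  by rewrite le_eqVlt; apply/orP; left; apply/eqP; congr `|_|; ring.
have h2 : `|d * sinc (x + d)| <= `|d|.
  by rewrite normrM ler_piMr// sinc_norm_le1.
lra.
Qed.

Lemma mul_sinc_diff2_le x d :
  `|x * (sinc (x + d) + sinc (x - d) - 2 * sinc x)| <= 3 * d ^+ 2.
Proof.
have -> : x * (sinc (x + d) + sinc (x - d) - 2 * sinc x) =
    (* The second difference of [sin] is [2 * sin x * (cos d - 1)]; the correction carries [d] times
       a first-order difference of [sinc], so both terms are of order [d ^ 2]. *)
    2 * sin x * (cos d - 1) - d * ((sinc (x + d) - sinc x) - (sinc (x - d) - sinc x)).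
  have : sin (x + d) + sin (x - d) = 2 * sin x * cos d by rewrite sinD sinB; ring.
  by rewrite -!mulr_sinc => h; lra.
have d2 : `|d| * `|d| = d ^+ 2 by rewrite -expr2 real_normK ?num_real.
rewrite (le_trans (ler_normB _ _))//.
have h1 : `|2 * sin x * (cos d - 1)| <= d ^+ 2.
  have /andP[c0 c1] := oneBcos_bounds d.
  rewrite !normrM ger0_norm// [`|cos _ - 1|]distrC [`|1 - _|]ger0_norm//.
  by have := sin_max x; have := normr_ge0 (sin x); nra.
have h2 : `|d * ((sinc (x + d) - sinc x) - (sinc (x - d) - sinc x))| <= 2 * d ^+ 2.
  rewrite normrM -d2 mulrCA ler_wpM2l// (le_trans (ler_normB _ _))//.
  by have := sinc_diff_le x d; have := sinc_diff_le x (- d); rewrite normrN; lra.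
lra.
Qed.

End SincAndPowers.

(** * Second-order estimate for powers of the absolute value *)

Section PowerTaylor.
Context {R : realType}.
Implicit Types (x y a p s r : R).

Lemma sqr_le_of_norm x y : `|x| <= y -> x ^+ 2 <= y ^+ 2.
Proof.
move=> xy; rewrite -real_normK ?num_real// ler_sqr ?nnegrE//.
exact: le_trans xy.
Qed.

Lemma powR_MVT r x y : 0 < x -> 0 < y ->
  exists2 c, Num.min x y <= c <= Num.max x y &
    x `^ r - y `^ r = r * c `^ (r - 1) * (x - y).
Proof.
wlog xy : x y / y <= x.
  move=> H x0 y0; case/orP: (le_total y x) => xy; first exact: H.
  have [c cb E] := H _ _ xy y0 x0; exists c; first by rewrite minC maxC.
  by rewrite -[LHS]opprB E -mulrN opprB.
move=> x0 y0.
have dp (z : R) : 0 < z -> is_derive z 1 ((@powR R)^~ r) (r * z `^ (r - 1)).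
  exact: is_derive1_powR.
have cp : {within `[y, x], continuous ((@powR R)^~ r)}.
  apply: continuous_in_subspaceT => z; rewrite inE/= in_itv/= => /andP[yz _].
  apply/differentiable_continuous/derivable1_diffP.
  by case: (dp z (lt_le_trans y0 yz)).
have itv_yx z : z \in `]y, x[ -> y < z < x by rewrite in_itv.
have [c cyx E] := MVT_segment xy
  (fun z h => dp z (lt_trans y0 (proj1 (andP (itv_yx z h))))) cp.
exists c => //; first by rewrite min_r// max_l//; move: cyx; rewrite in_itv.
Qed.

Lemma powR_le_sqr s x : 2 <= s -> `|x| <= 1 -> `|x| `^ s <= x ^+ 2.
Proof.
move=> s2 x1; rewrite -[leRHS]real_normK ?num_real// -powR_mulrn//.
have [->|x0] := eqVneq x 0.
  by rewrite normr0 !powR0// gt_eqF//; lra.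
by apply: ger_powR => //; rewrite normr_gt0 x0.
Qed.

Lemma powR_exp_le_self r x : 1 <= r -> 0 <= x <= 1 -> x `^ r <= x.
Proof.
move=> r1 /andP[x0 x1]; have [->|xn0] := eqVneq x 0.
  by rewrite powR0// gt_eqF//; lra.
by apply: ge1r_powR => //; rewrite lt_neqAle eq_sym xn0 x0.
Qed.

(** [D] is the derivative at [a], fixed before [p] so that the linear terms at two neighbours of [a]
    can be added. The bound by [s * |a|] keeps a factor [|a|], which supplies decay when [a] is a
    value of [sinc]. *)
Lemma norm_powR_taylor s a : 2 <= s -> `|a| <= 1 ->
  exists2 D, `|D| <= s * `|a| &
    forall p, `|p| <= 1 ->
      `| `|p| `^ s - `|a| `^ s - D * (p - a)| <= (s ^+ 2 + 2) * (p - a) ^+ 2.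
Proof.
move=> s2; wlog a0 : a / 0 <= a.
  move=> H; have [/H//|an0] := leP 0 a.
  have := H (- a); rewrite !normrN => H' a1.
  have [|D Da Dp] := H' _ a1; first by lra.
  exists (- D); first by rewrite normrN.
  move=> p p1; have := Dp (- p); rewrite normrN => /(_ p1).
  have -> : - D * (p - a) = D * (- p - - a) by ring.
  by have -> : (p - a) ^+ 2 = (- p - - a) ^+ 2 by ring.
rewrite (ger0_norm a0) => a1.
have [->|an0] := eqVneq a 0.
  exists 0; first by rewrite normr0 mulr0.
  move=> p p1; have sn0 : s != 0 by rewrite gt_eqF//; lra.
  rewrite powR0// !subr0 mul0r subr0 ger0_norm ?powR_ge0//.
  by have := powR_le_sqr s p s2 p1; have := sqr_ge0 s; have := sqr_ge0 p; nra.
have {an0}ap : 0 < a by rewrite lt_neqAle eq_sym an0.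
have s1 : 1 <= s - 1 by lra.
have a01 : 0 <= a <= 1 by apply/andP.
have aa := powR_exp_le_self _ _ s1 a01.
have aa0 := powR_ge0 a (s - 1).
exists (s * a `^ (s - 1)).
  by rewrite ger0_norm ?ler_wpM2l// ?mulr_ge0//; lra.
(* For [p <= 0] the mean value theorem on powers is not applicable across 0. Instead, [|p|] and [a]
   are both at most [a - p], so each of the three terms is separately of order [(p - a) ^ 2]. *)
move=> p p1; have [p0|p0] := leP p 0.
  have pa : `|p| <= `|p - a| by rewrite ler0_norm// distrC ger0_norm; lra.
  have h1 := powR_le_sqr s p s2 p1.
  have h1' := powR_ge0 `|p| s.
  have h2 : a `^ s <= a ^+ 2.
    by have := powR_le_sqr s a s2; rewrite ger0_norm//; exact.
  have h2' := powR_ge0 a s.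
  have h3 : 0 <= a `^ (s - 1) * (a - p) <= a * (a - p).
    by rewrite mulr_ge0//= ?ler_wpM2r//; lra.
  rewrite ler_norml; move/andP: h3 => [h3 h4].
  have e : s * a `^ (s - 1) * (p - a) = - (s * (a `^ (s - 1) * (a - p))) by ring.
  rewrite e; set v := a `^ (s - 1) * (a - p) in h3 h4 *.
  have q1 : 0 <= s * v by apply: mulr_ge0 => //; lra.
  have q2 : s * v <= s * (a * (a - p)) by apply: ler_wpM2l => //; lra.
  have q3 : s * (a * (a - p)) <= s ^+ 2 * (p - a) ^+ 2.
    have : a * (a - p) <= (p - a) ^+ 2 by nra.
    have : 0 <= a * (a - p) by rewrite mulr_ge0//; lra.
    by nra.
  have q4 : p ^+ 2 <= (p - a) ^+ 2 by nra.
  have q5 : a ^+ 2 <= (p - a) ^+ 2 by nra.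
  have q6 := sqr_ge0 (p - a).
  by apply/andP; split; lra.
rewrite gtr0_norm// in p1 *.
(* The mean value theorem is applied twice, first to the power [s] and then to its derivative;
   [s >= 2] keeps the last power of [d <= 1] at most 1. *)
have [c /andP[c1 c2] E] := powR_MVT s p a p0 ap.
have c0 : 0 < c by apply: lt_le_trans c1; rewrite lt_min p0.
have cle1 : c <= 1 by rewrite (le_trans c2)// ge_max p1.
have [d /andP[d1 d2] E2] := powR_MVT (s - 1) c a c0 ap.
have d0 : 0 < d by apply: lt_le_trans d1; rewrite lt_min c0.
have dle1 : d <= 1 by rewrite (le_trans d2)// ge_max cle1.
rewrite E -mulrBl -mulrBr E2.
have ds : `|d `^ (s - 1 - 1)| <= 1.
  have r0 : 0 <= s - 1 - 1 by lra.
  have := ge0_ler_powR r0 _ _ dle1; rewrite !nnegrE powR1 (ltW d0) ler01.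
  by rewrite ger0_norm ?powR_ge0//; apply.
have ca : `|c - a| <= `|p - a|.
  case/orP: (le_total p a) => pa.
    rewrite min_l// in c1; rewrite max_r// in c2.
    by rewrite distrC [`|p - a|]distrC !ger0_norm; lra.
  rewrite min_r// in c1; rewrite max_l// in c2.
  by rewrite !ger0_norm; lra.
rewrite !normrM (ger0_norm (_ : 0 <= s)) ?(ger0_norm (_ : 0 <= s - 1)); [|lra..].
have -> : (p - a) ^+ 2 = `|p - a| ^+ 2 by rewrite real_normK ?num_real.
set u := `|p - a| in ca *; set v := `|c - a| in ca *; set w := `|_ `^ _| in ds *.
have u0 : 0 <= u by exact: normr_ge0.
have v0 : 0 <= v by exact: normr_ge0.
have w0 : 0 <= w by exact: normr_ge0.
have wv : w * v <= u by nra.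
have wvu : w * v * u <= u ^+ 2 by rewrite expr2 ler_wpM2r.
have wvu0 : 0 <= w * v * u by rewrite !mulr_ge0.
have -> : s * ((s - 1) * w * v) * u = (s * (s - 1)) * (w * v * u) by ring.
have ss : 0 <= s * (s - 1) by rewrite mulr_ge0; lra.
by nra.
Qed.

End PowerTaylor.

(** * Quadratic decay of the spline *)

Section SplineDecay.
Context {R : realType}.
Local Notation mu := (@lebesgue_measure R).

Definition spline_hat (s w : R) : R := `|sinc (w / 2)| `^ s.

(** As [|sinc| <= 1] and [s >= 2], the power is at most the square of [sinc], and [(w / 2) ^ 2]
    times that square is a squared sine. *)
Lemma spline_hat_bound (s : R) : 2 <= s -> forall w,
  `|spline_hat s w| <= 8 / (1 + w ^+ 2).
Proof.
move=> s2 w; rewrite /spline_hat ger0_norm ?powR_ge0//.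
have w1 : 0 < 1 + w ^+ 2 by have := sqr_ge0 w; lra.
rewrite ler_pdivlMr//.
have := powR_le_sqr s _ s2 (sinc_norm_le1 (w / 2)).
have := sqr_le_of_norm _ _ (sinc_norm_le1 (w / 2)).
have := sqr_le_of_norm _ _ (sin_max (w / 2)).
rewrite -mulr_sinc exprMn => h1 h2 h3.
have h0 := powR_ge0 `|sinc (w / 2)| s.
rewrite exprMn in h1.
have w0 := sqr_ge0 w.
by nra.
Qed.

(** The Taylor estimate at both neighbours with the same [D] leaves two quadratic remainders and [D]
    times the second difference of [sinc]. Each of these decays like [1 / (1 + x ^ 2)]. *)
Lemma spline_hat_diff2 (s : R) : 2 <= s ->
  exists2 C, 0 <= C & forall w d, 
  `|spline_hat s (w + d) + spline_hat s (w - d) - 2 * spline_hat s w| <=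
    C * d ^+ 2 / (1 + w ^+ 2).
Proof.
(* Each remainder contributes [5 * (s ^ 2 + 2)], from [1 + 4] in the first-difference bounds, and
   the linear term contributes [4 * s]. The factor 4 lost in [1 + w ^ 2 <= 4 * (1 + x ^ 2)] is
   absorbed by [d ^ 2 = 4 * e ^ 2]. *)
move=> s2; exists (4 * s + 10 * (s ^+ 2 + 2)).
  by have := sqr_ge0 s; lra.
move=> w d; rewrite /spline_hat.
set x := w / 2; set e := d / 2.
have -> : (w + d) / 2 = x + e by rewrite mulrDl.
have -> : (w - d) / 2 = x - e by rewrite mulrBl.
have e2 : d ^+ 2 = 4 * e ^+ 2 by rewrite /e; field.
have wx : 1 + w ^+ 2 <= 4 * (1 + x ^+ 2) by rewrite /x; have := sqr_ge0 w; lra.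
clearbody x e.
set a := sinc x; set p := sinc (x + e); set q := sinc (x - e).
have [D Da Dp] := norm_powR_taylor _ _ s2 (sinc_norm_le1 x).
have Tp := Dp _ (sinc_norm_le1 (x + e)).
have Tq := Dp _ (sinc_norm_le1 (x - e)).
rewrite -/a -/p -/q in Da Tp Tq *.
have E : `|p| `^ s + `|q| `^ s - 2 * `|a| `^ s =
  (`|p| `^ s - `|a| `^ s - D * (p - a)) + (`|q| `^ s - `|a| `^ s - D * (q - a)) +
  D * (p + q - 2 * a) by ring.
have w1 : 0 < 1 + w ^+ 2 by have := sqr_ge0 w; lra.
rewrite ler_pdivlMr//.
have P1 := sqr_le_of_norm _ _ (sinc_diff_le x e).
have P2 := sqr_le_of_norm _ _ (mul_sinc_diff_le x e).
have Q1 := sqr_le_of_norm _ _ (sinc_diff_le x (- e)).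
have Q2 := sqr_le_of_norm _ _ (mul_sinc_diff_le x (- e)).
rewrite normrN in Q1 Q2; rewrite !exprMn real_normK ?num_real// in P1 P2 Q1 Q2.
have R1 := sinc_diff2_le x e.
have R2 := mul_sinc_diff2_le x e.
rewrite -/a -/p -/q in P1 P2 Q1 Q2 R1 R2.
have xa : `|x * a| <= 1 by rewrite mulr_sinc sin_max.
have a1 : `|a| <= 1 by exact: sinc_norm_le1.
have M0 : 0 <= s ^+ 2 + 2 by have := sqr_ge0 s; lra.
set M := s ^+ 2 + 2 in Tp Tq M0 *.
have s0 : 0 <= s by lra.
set Z := p + q - 2 * a in E R1 R2.
(* One power of [x] is paired with [a], where [x * a] is a sine, and the other with the second
   difference [Z]. *)
have aZ : `|a| * `|Z| * (1 + x ^+ 2) <= 4 * e ^+ 2.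
  have -> : `|a| * `|Z| * (1 + x ^+ 2) = `|a| * `|Z| + `|x * a| * `|x * Z|.
    rewrite [`|x * a|]normrM [`|x * Z|]normrM.
    have <- : `|x| ^+ 2 = x ^+ 2 by rewrite real_normK ?num_real.
    by ring.
  have e0 := sqr_ge0 e.
  have g1 : `|a| * `|Z| <= 1 * e ^+ 2 by rewrite ler_pM.
  have g2 : `|x * a| * `|x * Z| <= 1 * (3 * e ^+ 2) by rewrite ler_pM.
  by lra.
have DZ : `|D * Z| * (1 + x ^+ 2) <= s * (4 * e ^+ 2).
  rewrite normrM; have : `|D| * `|Z| <= s * `|a| * `|Z| by rewrite ler_wpM2r.
  have x1 : 0 <= 1 + x ^+ 2 by have := sqr_ge0 x; lra.
  move=> /(ler_wpM2r x1) h; apply: (le_trans h).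
  by rewrite -!mulrA ler_wpM2l// mulrA.
have Pp : M * (p - a) ^+ 2 * (1 + x ^+ 2) <= M * (5 * e ^+ 2).
  by rewrite -mulrA ler_wpM2l//; lra.
have Pq : M * (q - a) ^+ 2 * (1 + x ^+ 2) <= M * (5 * e ^+ 2).
  by rewrite -mulrA ler_wpM2l//; lra.
have tri : `| `|p| `^ s + `|q| `^ s - 2 * `|a| `^ s| <=
    M * (p - a) ^+ 2 + M * (q - a) ^+ 2 + `|D * Z|.
  rewrite E (le_trans (ler_normD _ _))// lerD2r.
  by rewrite (le_trans (ler_normD _ _))// lerD.
set T := `|_| in tri *.
have T0 : 0 <= T by exact: normr_ge0.
apply: (@le_trans _ _ (T * (4 * (1 + x ^+ 2)))); first by rewrite ler_wpM2l.
rewrite e2.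
have x1 : 0 <= 1 + x ^+ 2 by have := sqr_ge0 x; lra.
have key := ler_wpM2r x1 tri; rewrite 2!mulrDl in key.
clearbody M Z T; rewrite (mulrCA T 4).
have {key} : T * (1 + x ^+ 2) <= (4 * s + 10 * M) * e ^+ 2.
  apply: (le_trans key).
  have -> : (4 * s + 10 * M) * e ^+ 2 =
    M * (5 * e ^+ 2) + M * (5 * e ^+ 2) + s * (4 * e ^+ 2) by ring.
  by rewrite !lerD.
by move=> h; rewrite (mulrCA _ 4) ler_wpM2l.
Qed.

Lemma spline_decay (beta : R -> R) (s : R) : 2 <= s -> L1 beta ->
  (forall w p, \int[mu]_t (beta t * cos (w * t + p)) = spline_hat s w * cos p) ->
  exists2 C, 0 <= C & {ae mu, forall t, `|beta t| <= C / (1 + t ^+ 2)}.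
Proof.
move=> s2 lb hb.
have b0 := ae_bound_of_fourier beta (spline_hat s) 8 lb hb (spline_hat_bound s s2).
have [C C0 HC] := spline_hat_diff2 s s2.
(* Multiplying by [2 - 2 * cos (d * t)] with [d = 1 / (n + 1)] replaces the transform by minus its
   second difference of step [d], of size [d ^ 2 / (1 + w ^ 2)]. Using countably many steps keeps
   the exceptional set null. *)
pose f n t := beta t * (2 - 2 * cos (n.+1%:R^-1 * t)).
have fE n t w p : f n t * cos (w * t + p) = 2 * (beta t * cos (w * t + p)) -
    (beta t * cos ((w + n.+1%:R^-1) * t + p) + beta t * cos ((w - n.+1%:R^-1) * t + p)).
  rewrite /f.
  have -> : (w + n.+1%:R^-1) * t + p = (w * t + p) + n.+1%:R^-1 * t by ring.
  have -> : (w - n.+1%:R^-1) * t + p = (w * t + p) - n.+1%:R^-1 * t by ring.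
  by rewrite (cosD (w * t + p)) (cosB (w * t + p)); ring.
have lc w p : L1 (fun t => beta t * cos (w * t + p)) by exact: L1_cos_affine.
have lf n : L1 (f n).
  have := L1B _ _ (L1Z 2 _ (lc 0 0)) (L1D _ _ (lc (0 + n.+1%:R^-1) 0) (lc (0 - n.+1%:R^-1) 0)).
  by apply: L1_ext => t; rewrite -fE mul0r addr0 cos0 mulr1.
pose F n w := 2 * spline_hat s w - (spline_hat s (w + n.+1%:R^-1) + spline_hat s (w - n.+1%:R^-1)).
have Ff n w p : \int[mu]_t (f n t * cos (w * t + p)) = F n w * cos p.
  under Rintegral_ext do rewrite fE.
  rewrite RintegralB//; [|exact: L1Z|exact: L1D].
  rewrite (RintegralZl _ measurableT (lc w p)) (RintegralD measurableT (lc _ _) (lc _ _)).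
  by rewrite !hb /F; ring.
have FM n w : `|F n w| <= (C * n.+1%:R^-1 ^+ 2) / (1 + w ^+ 2).
  by rewrite /F -normrN opprB.
have bn n := ae_bound_of_fourier _ _ _ (lf n) (Ff n) (FM n).
(* The sup bound gives [5 * 8 = 40] for [|beta t|]. For [|beta t| * t ^ 2] it gives [4 * 5 * C], the
   4 coming from the lower bound [y ^ 2 / 4] on the multiplier. *)
exists (40 + 20 * C); first by lra.
apply: ae_imply2 b0 (ae_foralln bn) => t h0 hn.
have t1 : 0 < 1 + t ^+ 2 by have := sqr_ge0 t; lra.
rewrite ler_pdivlMr// mulrDr mulr1; apply: lerD; first lra.
near \oo => n.
have tn : `|t| <= n.+1%:R.
  rewrite -natr1; have : `|t| <= n%:R by near: n; exact: nbhs_infty_ger.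
  by lra.
have := hn n; rewrite /f.
set y := n.+1%:R^-1 * t.
have n0 : 0 < n.+1%:R :> R by rewrite ltr0n.
have y1 : `|y| <= 1.
  by rewrite normrM gtr0_norm ?invr_gt0// mulrC ler_pdivrMr// mul1r.
(* The multiplier equals [y ^ 2 * sinc (y / 2) ^ 2], and [sinc (y / 2) >= 1 / 2] for [|y| <= 1]. *)
have ylow : y ^+ 2 / 4 <= 2 - 2 * cos y.
  have -> : 2 - 2 * cos y = 4 * sin (y / 2) ^+ 2.
    have := cos_mulr2n (y / 2); have := cos2Dsin2 (y / 2).
    by rewrite -[(y / 2) *+ 2]mulr_natr divfK// => h1 ->; lra.
  rewrite -mulr_sinc [_ ^+ 2 in leRHS]exprMn; have := sinc_ge (y / 2).
  have y2 : y ^+ 2 <= 1 by rewrite -real_normK ?num_real// exprn_ile1.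
  have y0 := sqr_ge0 y.
  rewrite exprMn => hs.
  have hs' : 2^-1 <= sinc (y / 2) by lra.
  have hs2 : 4^-1 <= sinc (y / 2) ^+ 2 by nra.
  have -> : 4 * (y ^+ 2 * 2^-1 ^+ 2 * sinc (y / 2) ^+ 2) = y ^+ 2 * sinc (y / 2) ^+ 2.
    by field.
  by rewrite ler_wpM2l.
have yt : y ^+ 2 = t ^+ 2 / n.+1%:R ^+ 2 by rewrite /y; field; rewrite gt_eqF.
rewrite normrM [`|2 - _|]ger0_norm; last first.
  by have := sqr_ge0 y; lra.
move=> H; have : `|beta t| * (y ^+ 2 / 4) <= 5 * (C * n.+1%:R^-1 ^+ 2).
  by apply: le_trans H; rewrite ler_wpM2l.
rewrite yt exprVn.
have -> : `|beta t| * (t ^+ 2 / n.+1%:R ^+ 2 / 4) = `|beta t| * t ^+ 2 / 4 / n.+1%:R ^+ 2.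
  by field; rewrite gt_eqF.
rewrite !mulrA ler_pM2r ?invr_gt0 ?exprn_gt0//; lra.
Unshelve. all: by end_near. Qed.

End SplineDecay.

(** * Poisson summation *)

Section Periodization.
Context {R : realType}.
Implicit Types (f g : R -> R) (t x C : R).
Local Notation mu := (@lebesgue_measure R).

(** Half-open, unlike [window 1], so that its integer translates tile the line exactly. *)
Definition unit_window : R -> R := \1_`[- 2^-1, 2^-1[%classic.

Lemma unit_window_itv t : unit_window t = (- 2^-1 <= t < 2^-1)%R%:R.
Proof. by rewrite /unit_window indicE mem_setE in_itv. Qed.

Lemma L1_unit_window : L1 unit_window.
Proof.
apply: L1_indic => //; rewrite lebesgue_measure_itv/=.
by case: ifP => // _; rewrite -EFinB ltry.
Qed.

(* The integer translates are paired as [n] and [- (n + 1)], n >= 0. *)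
Definition translates f t (n : nat) : R := f (t + n%:R) + f (t - n.+1%:R).

Definition periodization f t : R := limn (series (translates f t)).

Lemma decay_translate f C t x : (forall t, `|f t| <= C / (1 + t ^+ 2)) ->
  `|t| <= 2^-1 -> `|f (t + x)| <= 4 * C / (1 + x ^+ 2).
Proof.
move=> fC th; apply: (le_trans (fC _)).
have C0 : 0 <= C by have := fC 0; rewrite expr0n addr0 divr1; apply: le_trans.
have p1 (y : R) : 0 < 1 + y ^+ 2 by have := sqr_ge0 y; lra.
rewrite [4 * C]mulrC -mulrA ler_wpM2l// ler_pdivlMr// mulrC ler_pdivrMr//.
move: th; rewrite ler_norml => /andP[t1 t2].
have tt : t ^+ 2 <= 1 / 4 by nra.
(* The difference [4 * (1 + (t + x) ^ 2) - (1 + x ^ 2)] equals [(3 * x + 4 * t) ^ 2 / 3 + 3 - 4 * t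
   ^ 2 / 3]. *)
by have := sqr_ge0 (3 * x + 4 * t); lra.
Qed.

Lemma summable_inv_oneDsqr : cvgn (series (fun n => (1 + n%:R ^+ 2)^-1 : R)).
Proof.
have [] := telescoping_series_bound (fun n => (1 + n%:R ^+ 2)^-1 : R)
  (fun n => 4 / n.+1%:R).
- move=> k; rewrite ger0_norm ?invr_ge0 ?addr_ge0 ?sqr_ge0//.
  have k0 := ler0n R k.
  have -> : 4 / k.+1%:R - 4 / k.+2%:R = 4 / ((k%:R + 1) * (k%:R + 2)) :> R.
    rewrite -[k.+2]addn2 -[k.+1]addn1 !natrD; field.
    by apply/andP; split; rewrite gt_eqF//; lra.
  rewrite ler_pdivlMr; last by rewrite mulr_gt0//; lra.
  rewrite mulrC ler_pdivrMr; last by have := sqr_ge0 (k%:R : R); lra.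
  by have := sqr_ge0 (k%:R - 2^-1 : R); nra.
- by move=> k; rewrite divr_ge0.
- by [].
Qed.

Lemma decay_translates f C t n : (forall t, `|f t| <= C / (1 + t ^+ 2)) ->
  `|t| <= 2^-1 -> `|translates f t n| <= 8 * C * (1 + n%:R ^+ 2)^-1.
Proof.
move=> fC th.
have C0 : 0 <= C by have := fC 0; rewrite expr0n addr0 divr1; apply: le_trans.
rewrite /translates (le_trans (ler_normD _ _))//.
have h1 := decay_translate _ _ _ n%:R fC th.
have h2 := decay_translate _ _ _ (- n.+1%:R) fC th.
have h3 : (1 + (- n.+1%:R) ^+ 2)^-1 <= (1 + n%:R ^+ 2)^-1 :> R.
  have p1 (y : R) : 0 < 1 + y ^+ 2 by have := sqr_ge0 y; lra.
  rewrite lef_pV2 ?posrE//.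
  by rewrite sqrrN lerD2l ler_sqr ?nnegrE// ler_nat.
have h4 : 4 * C * (1 + (- n.+1%:R) ^+ 2)^-1 <= 4 * C * (1 + n%:R ^+ 2)^-1.
  by rewrite ler_wpM2l// mulr_ge0.
lra.
Qed.

Lemma periodization_cvg f C t : (forall t, `|f t| <= C / (1 + t ^+ 2)) ->
  `|t| <= 2^-1 -> cvgn (series (translates f t)).
Proof.
move=> fC th; apply: normed_cvg => /=.
apply: (series_le_cvg _ _ (fun n => decay_translates f C t n fC th)) => //.
  by move=> n; apply: le_trans (decay_translates f C t n fC th).
exact: (is_cvg_seriesZ (k := 8 * C) summable_inv_oneDsqr).
Qed.

Lemma measurable_shift f x : measurable_fun setT f ->
  measurable_fun setT (fun t => f (t + x)).
Proof.
move=> mf; apply: (measurableT_comp mf).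
by apply: measurable_funD.
Qed.

(** The cells centred at [0, ..., N - 1] and [-1, ..., -N] are adjacent; their union is centred at
    [- 1 / 2] rather than 0 because of the pairing of [n] with [- (n + 1)]. *)
Lemma unit_window_translates (N : nat) t :
  \sum_(0 <= n < N) (unit_window (t - n%:R) + unit_window (t + n.+1%:R)) =
  (- N%:R - 2^-1 <= t < N%:R - 2^-1)%R%:R.
Proof.
elim: N => [|N IHN].
  rewrite big_geq//; have -> // : (- 0%:R - 2^-1 <= t < 0%:R - 2^-1) = false.
  by apply/negP => /andP[]; lra.
rewrite big_nat_recr//= {}IHN !unit_window_itv -[N.+1%:R]natr1.
have N0 := ler0n R N.
have -> : (- 2^-1 <= t - N%:R < 2^-1) = (N%:R - 2^-1 <= t < N%:R + 1 - 2^-1).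
  by apply/idP/idP => /andP[? ?]; apply/andP; split; lra.
have -> : (- 2^-1 <= t + (N%:R + 1) < 2^-1) =
    (- (N%:R + 1) - 2^-1 <= t < - N%:R - 2^-1).
  by apply/idP/idP => /andP[? ?]; apply/andP; split; lra.
case: (leP (N%:R - 2^-1) t) => h1; case: (ltP t (N%:R + 1 - 2^-1)) => h2;
  case: (leP (- N%:R - 2^-1) t) => h3;
  case: (leP (- (N%:R + 1) - 2^-1) t) => h4; rewrite /= ?(addr0, add0r)//; lra.
Qed.

Lemma L1_unit_windowM f x : L1 f -> L1 (fun t => f t * unit_window (t + x)).
Proof.
move=> lf; apply: (L1Mb _ _ 1) => //.
  exact: (measurable_shift _ _ (L1_measurable _ L1_unit_window)).
by move=> t; exact: indic_norm_le1.
Qed.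

(** Unfolding: moving each translate back to its own cell turns the partial sums into integrals of
    [g] over intervals that exhaust the line. *)
Lemma Rintegral_periodization g C : L1 g ->
  (forall t, `|g t| <= C / (1 + t ^+ 2)) ->
  L1 (fun t => unit_window t * periodization g t) /\
  \int[mu]_t (unit_window t * periodization g t) = \int[mu]_t g t.
Proof.
move=> lg gC; have mg := L1_measurable _ lg.
have C0 : 0 <= C by have := gC 0; rewrite expr0n addr0 divr1; apply: le_trans.
have uw t : `|unit_window t| <= 1 by exact: indic_norm_le1.
have uw0 t : 0 <= unit_window t by rewrite unit_window_itv.
have uwh t : unit_window t != 0 -> `|t| <= 2^-1.
  rewrite unit_window_itv; case: andP => [[t1 t2] _|]; last by rewrite eqxx.
  by rewrite ler_norml t1 ltW.
pose f_ n t := unit_window t * translates g t n.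
have mf n : measurable_fun setT (f_ n).
  apply: measurable_funM; first exact: (L1_measurable _ L1_unit_window).
  by apply: measurable_funD; exact: measurable_shift.
have fb n t : `|f_ n t| <= (8 * C * (1 + n%:R ^+ 2)^-1) * unit_window t.
  rewrite /f_; have [->|/[dup] u0 /uwh th] := eqVneq (unit_window t) 0.
    by rewrite mul0r mulr0 normr0.
  rewrite normrM mulrC (ger0_norm (uw0 t)).
  by apply: ler_wpM2r => //; exact: decay_translates.
have cc : cvgn (series (fun n => 8 * C * (1 + n%:R ^+ 2)^-1)).
  exact: (is_cvg_seriesZ (k := 8 * C) summable_inv_oneDsqr).
have [fcv l1 lim1] := Rintegral_series f_ _ _ mf L1_unit_window cc
  uw0 fb.
have E t : limn (series (f_ ^~ t)) = unit_window t * periodization g t.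
  have [u0|/uwh th] := eqVneq (unit_window t) 0.
    rewrite u0 mul0r (_ : f_ ^~ t = fun=> 0); last by apply/funext => n; rewrite /f_ u0 mul0r.
    apply/cvg_lim => //; apply: (cvg_near_cst 0); apply: nearW => n.
    by rewrite /series/= big1.
  exact: (lim_seriesZ (unit_window t) (periodization_cvg _ _ _ gC th)).
split; first by apply: L1_ext l1.
transitivity (\int[mu]_t limn (series (f_ ^~ t))).
  by apply: Rintegral_ext => t; rewrite E.
apply: cvg_unique lim1 _ => //.
pose G_ N t := g t * (- N%:R - 2^-1 <= t < N%:R - 2^-1)%R%:R.
have ls n : L1 (fun t => g t * unit_window (t + n)) by exact: L1_unit_windowM.
have fE n : \int[mu]_t f_ n t =
    \int[mu]_t (g t * unit_window (t - n%:R) + g t * unit_window (t + n.+1%:R)).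
  have [l2 i2] := Rintegral_shift _ n%:R (ls (- n%:R)).
  have [l3 i3] := Rintegral_shift _ (- n.+1%:R) (ls n.+1%:R).
  rewrite RintegralD//; [|exact: ls..].
  rewrite -i2 -i3 -RintegralD//; apply: Rintegral_ext => t.
  by rewrite /f_ /translates addrK subrK; ring.
have lss n : L1 (fun t => g t * unit_window (t - n%:R) + g t * unit_window (t + n.+1%:R)).
  by apply: L1D; exact: ls.
have GE N : series (fun n => \int[mu]_t f_ n t) N = \int[mu]_t G_ N t.
  transitivity (\int[mu]_t \sum_(0 <= n < N)
    (g t * unit_window (t - n%:R) + g t * unit_window (t + n.+1%:R))); last first.
    apply: Rintegral_ext => t; rewrite /G_ -unit_window_translates mulr_sumr.
    by apply: eq_bigr => n _; rewrite mulrDr.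
  rewrite /series/=; elim: N => [|N IHN].
    by under Rintegral_ext do rewrite big_geq//; rewrite big_geq// Rintegral_cst// mul0r.
  rewrite big_nat_recr//= IHN fE; under [RHS]Rintegral_ext do rewrite big_nat_recr//=.
  rewrite [RHS]RintegralD//; last exact: lss.
  exact: (L1_sum (fun n t => g t * unit_window (t - n%:R) + g t * unit_window (t + n.+1%:R))).
rewrite (funext GE).
have lG N : L1 (G_ N).
  have := L1_sum (fun n t => g t * unit_window (t - n%:R) + g t * unit_window (t + n.+1%:R)) N
    lss.
  apply: L1_ext => t; rewrite /G_ -unit_window_translates mulr_sumr.
  by apply: eq_bigr => n _; rewrite mulrDr.
have Gb N t : `|G_ N t| <= `|g t|.
  by rewrite normrM ler_piMr// normr_nat lern1 leq_b1.
have Glim t : G_ ^~ t @ \oo --> g t.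
  apply: (cvg_near_cst (g t)); near=> N.
  have tN : `|t| + 1 <= N%:R by near: N; exact: nbhs_infty_ger.
  rewrite /G_ (_ : - N%:R - 2^-1 <= t < N%:R - 2^-1) ?mulr1//.
  have := ler_norm t; have := ler_norm (- t); rewrite normrN => ? ?.
  by apply/andP; split; lra.
by have [] := Rintegral_dominated _ _ _ (fun N => L1_measurable _ (lG N)) (L1_norm _ lg) Gb Glim.
Unshelve. all: by end_near. Qed.

(** Poisson summation. The indicator [A] of an arc has period 1, so it factors out of the
    periodization. Unfolding then gives the integral of [f * A], which equals the integral of the
    harmonic sum over the ball. Equality of all small averages gives equality almost everywhere. *)
Lemma periodization_fourier f (C c0 : R) (c : nat -> R) q : L1 f ->
  (forall t, `|f t| <= C / (1 + t ^+ 2)) ->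
  cvgn (series (fun k => `|c k|)) ->
  \int[mu]_t f t = c0 ->
  (forall k p, \int[mu]_t (f t * cos (k.+1%:R * (2 * pi / 1) * t + p)) =
    c k * cos (p - q)) ->
  {ae mu, forall t, `|t| < 2^-1 -> periodization f t = harmonic_sum 1 c0 c q t}.
Proof.
move=> lf fC cc f0 fc.
have mU := L1_measurable _ L1_unit_window.
have U1 t : `|unit_window t| <= 1 by exact: indic_norm_le1.
have UW t : `|t| < 2^-1 -> unit_window t = 1 /\ window 1 t = 1.
  rewrite ltr_norml window_itv unit_window_itv => /andP[t1 t2].
  by rewrite t2 !div1r !ltW.
have [lP _] := Rintegral_periodization f C lf fC.
have [lS _] := window_harmonic_sum 1 ltr01 c0 c q cc.
pose D t := unit_window t * periodization f t - window 1 t * harmonic_sum 1 c0 c q t.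
have lD : L1 D by exact: L1B.
suff : {ae mu, forall t, [set t | `|t| < 2^-1] t -> `|D t| <= 0}.
  apply: ae_imply => t /= tD /[dup] /tD; rewrite normr_le0 => /eqP + /UW[U1t W1t].
  by rewrite /D U1t W1t !mul1r => /eqP; rewrite subr_eq0 => /eqP.
apply: ae_le_of_averages => // x /= xh; exists (2^-1 - `|x|); first by rewrite subr_gt0.
move=> r /andP[r0 rx]; rewrite mul0r normr_le0; apply/eqP.
have xr : `|x| + r < 1 / 2 by lra.
have arc := Rintegral_arc 1 ltr01 f c0 c q x r lf cc f0 fc r0 xr.
set om := 2 * pi / 1 in arc.
set A := fun t => (cos (om * r) < cos (om * t - om * x))%R%:R : R in arc.
have mA : measurable_fun setT A by exact: measurable_arc.
have A1 t : `|A t| <= 1 by rewrite normr_nat lern1 leq_b1.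
have Aper t m : A (t + m%:R) = A t.
  rewrite /A; congr (_ < _)%R%:R.
  have -> : om * (t + m%:R) - om * x = om * t - om * x + (pi *+ 2) *+ m.
    by rewrite -[(pi *+ 2) *+ _]mulr_natl -[pi *+ 2]mulr_natl /om; field.
  by rewrite (periodicn (@cosD2pi R)).
have Aperm t m : A (t - m%:R) = A t by rewrite -(Aper (t - m%:R) m) subrK.
have lfA : L1 (fun t => f t * A t) by exact: (L1Mb _ _ 1).
have fAC t : `|f t * A t| <= C / (1 + t ^+ 2).
  by rewrite normrM (le_trans _ (fC t))// ler_piMr.
have [lPA iPA] := Rintegral_periodization _ C lfA fAC.
have ballE t : unit_window t != 0 -> A t = \1_(ball x r) t.
  rewrite unit_window_itv; case: andP => [[t1 t2] _|]; last by rewrite eqxx.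
  rewrite /A arc_ballE//; last by rewrite div1r ler_norml t1 ltW.
  by rewrite indicE; congr (nat_of_bool _)%:R; apply/idP/idP; rewrite inE.
have ballW t : \1_(ball x r) t != 0 :> R -> `|t| < 2^-1.
  rewrite indicE; have [/set_mem|] := boolP (t \in (ball x r : set R)); last by rewrite eqxx.
  rewrite /ball/= => xt _.
  by have := ler_normB x (x - t); rewrite opprB addrC subrK; lra.
have PA t : unit_window t * periodization (fun t => f t * A t) t =
    unit_window t * periodization f t * \1_(ball x r) t.
  have [->|u0] := eqVneq (unit_window t) 0; first by rewrite !mul0r.
  rewrite -ballE// -mulrA; congr *%R.
  rewrite /periodization (_ : translates _ t = A t *: translates f t); last first.
    apply/funext => n; rewrite /translates Aper Aperm.
    by rewrite [RHS](_ : _ = A t * (f (t + n%:R) + f (t - n.+1%:R)))//; ring.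
  rewrite lim_seriesZ; first by rewrite mulrC.
  apply: (periodization_cvg _ _ _ fC).
  move: u0; rewrite unit_window_itv; case: andP => [[t1 t2] _|]; last by rewrite eqxx.
  by rewrite ler_norml t1 ltW.
have mB := L1_measurable _ (L1_ball x r (ltW r0)).
have lPB : L1 (fun t => unit_window t * periodization f t * \1_(ball x r) t).
  by apply: (L1Mb _ _ 1) => // t; exact: indic_norm_le1.
have lSB : L1 (fun t => window 1 t * harmonic_sum 1 c0 c q t * \1_(ball x r) t).
  by apply: (L1Mb _ _ 1) => // t; exact: indic_norm_le1.
under Rintegral_ext do rewrite mulrBl.
rewrite RintegralB//.
have -> : \int[mu]_t (unit_window t * periodization f t * \1_(ball x r) t) =
    \int[mu]_t (f t * A t).
  by rewrite -iPA; apply: Rintegral_ext => t; rewrite PA.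
rewrite arc; apply/eqP; rewrite subr_eq0; apply/eqP.
apply: Rintegral_ext => t; have [->|/ballW/UW[_ ->]] := eqVneq (\1_(ball x r) t : R) 0.
  by rewrite !mulr0.
by rewrite mul1r.
Qed.

End Periodization.

(** * Positivity *)

Section Positivity.
Context {R : realType}.
Implicit Types (t w theta s c : R).

Lemma sin_addn_pi (x : R) (m : nat) : `|sin (x + m%:R * pi)| = `|sin x|.
Proof.
elim: m => [|m IHm]; first by rewrite mul0r addr0.
have -> : x + m.+1%:R * pi = (x + m%:R * pi) + pi by rewrite -natr1; ring.
by rewrite (sinDpi (x + m%:R * pi)) normrN.
Qed.

Lemma spline_hatN s w : spline_hat s (- w) = spline_hat s w.
Proof.
rewrite /spline_hat /sinc mulNr oppr_eq0 sinN.
by case: eqVneq => // _; rewrite invrN mulrNN.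
Qed.

(** The half frequencies differ by [m * pi], which leaves the absolute value of the sine unchanged;
    only the denominators of [sinc] differ. *)
Lemma spline_hat_translate s theta w (m : nat) :
  w = m%:R * (2 * pi) + theta -> theta != 0 -> 0 < w ->
  spline_hat s w = spline_hat s theta * (`|theta| / w) `^ s.
Proof.
move=> wE th0 w0.
have nz (x : R) : x != 0 -> (x / 2 == 0) = false.
  by move=> x0; rewrite mulf_eq0 (negbTE x0) invr_eq0 pnatr_eq0.
have wn0 : w != 0 by rewrite gt_eqF.
rewrite /spline_hat /sinc (nz _ wn0) (nz _ th0) -powRM//; last first.
  by rewrite divr_ge0// ltW.
have -> : `|sin (w / 2) / (w / 2)| = `|sin (theta / 2)| / (w / 2).
  rewrite normrM normfV (gtr0_norm (divr_gt0 w0 (ltr0n R 2))); congr (_ / _).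
  by rewrite -(sin_addn_pi _ m) wE; congr `|sin _|; field.
have -> : `|sin (theta / 2) / (theta / 2)| = `|sin (theta / 2)| / (`|theta| / 2).
  by rewrite !normrM normfV normrM [`|2^-1|]ger0_norm ?invr_ge0.
congr (_ `^ _); have t0 : `|theta| != 0 by rewrite normr_eq0.
by field; rewrite t0 wn0.
Qed.

(** After extracting [2^-1 ^ s], the power of [2 * x <= 1] is at most its square, and
    [(2 * k + 3) ^ 2 > 4 * (k + 1) * (k + 2)] makes the bound telescope, with total [2^-1 ^ s]. *)
Lemma powR_inv_odd_le s (k : nat) (x : R) : 2 <= s ->
  0 <= x -> x * (2 * k%:R + 3) <= 1 ->
  x `^ s <= 2^-1 `^ s * (k.+1%:R^-1 - k.+2%:R^-1).
Proof.
move=> s2 x0 xk.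
have k0 := ler0n R k.
have x2 : 2 * x <= 1 by nra.
have -> : x = 2^-1 * (2 * x) by field.
rewrite powRM ?mulr_ge0// ler_wpM2l ?powR_ge0//.
have := powR_le_sqr s (2 * x) s2; rewrite ger0_norm ?mulr_ge0// => /(_ x2) h.
apply: (le_trans h); rewrite exprMn.
have -> : k.+1%:R^-1 - k.+2%:R^-1 = ((k%:R + 1) * (k%:R + 2))^-1 :> R.
  rewrite -[k.+2]addn2 -[k.+1]addn1 !natrD; field.
  by apply/andP; split; rewrite gt_eqF//; lra.
rewrite -[leRHS]div1r ler_pdivlMr; last by rewrite mulr_gt0//; lra.
have hx : (x * (2 * k%:R + 3)) ^+ 2 <= 1.
  by rewrite exprn_ile1// mulr_ge0//; lra.
by have := sqr_ge0 x; nra.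
Qed.

(** Both [2 * c ^ 2 < 1] and [c < 1] come from [c ^ 3 <= 1 / 4]. They make [c] and [2 * c ^ 2]
    exceed [2 * c ^ 3], the size of the tail. The radius below [1 / 2] puts the support inside one
    period. *)
Lemma support_radius_cos (sigma : R) : 1 < sigma ->
  exists c, [/\ 0 < c < 1, 2 * c ^+ 2 < 1, c ^+ 3 = 2^-1 `^ (sigma + 1),
    0 < support_radius sigma < 2^-1 &
    cos (pi * support_radius sigma) = c].
Proof.
move=> s1; pose s := sigma + 1.
have s2 : 2 < s by rewrite /s; lra.
pose c : R := (1 / 2 `^ s) `^ (1 / 3).
have inv2 : 1 / 2 `^ s = 2^-1 `^ s :> R.
  by rewrite div1r -powRN -(powR_inv1 (ler0n R 2)) -powRrM mulN1r.
have hs0 : 0 < 2^-1 `^ s :> R by rewrite powR_gt0// invr_gt0.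
have c0 : 0 < c by rewrite /c inv2 powR_gt0.
have c3 : c ^+ 3 = 2^-1 `^ s.
  by rewrite /c inv2 -powR_mulrn ?powR_ge0// -powRrM divfK// powRr1// ltW.
have hs : 2^-1 `^ s <= 4^-1 :> R.
  have := powR_le_sqr s (2^-1) (ltW s2); rewrite ger0_norm ?invr_ge0//; lra.
have c1 : c < 1 by rewrite ltNge; apply/negP => c1; nra.
have c2 : 2 * c ^+ 2 < 1.
  rewrite ltNge; apply/negP => h.
  have : c ^+ 3 ^+ 2 <= 4^-1 ^+ 2.
    by rewrite ler_sqr ?nnegrE ?exprn_ge0 ?(ltW c0)// c3.
  have -> : c ^+ 3 ^+ 2 = c ^+ 2 ^+ 3 by rewrite -!exprM.
  set d := c ^+ 2 in h *; move=> h'; nra.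
have cin : -1 <= c <= 1 by apply/andP; split; lra.
have pi0 := pi_gt0 R.
have lE : support_radius sigma = pi^-1 * acos c.
  by rewrite /support_radius div1r.
have piL : pi * support_radius sigma = acos c.
  by rewrite lE mulrA divff ?mul1r// gt_eqF.
have cosa : cos (acos c) = c by apply: acosK; rewrite in_itv.
have a0 : 0 < acos c by apply: acos_gt0; apply/andP; split; lra.
have apih : acos c < pi / 2.
  have api := acos_lepi cin.
  rewrite -ltr_cos ?cosa ?cos_pihalf//; rewrite in_itv/=; apply/andP; split; lra.
exists c; split => //.
- by rewrite c0.
- by rewrite -[in X in _ && X](ltr_pM2l pi0) piL lE mulr_gt0// invr_gt0.
- by rewrite piL.
Qed.

(** The Poisson terms at [theta + 2 * pi * m] for [m = k + 1] and [m = - (k + 1)], the latter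
    written at the opposite frequency since transform and cosine are even. *)
Definition pair_term s theta t (k : nat) : R :=
  spline_hat s (k.+1%:R * (2 * pi) + theta) * cos ((k.+1%:R * (2 * pi) + theta) * t) +
  spline_hat s (k.+1%:R * (2 * pi) - theta) * cos ((k.+1%:R * (2 * pi) - theta) * t).

Lemma cos_ge_of_le (x y : R) : `|x| <= y -> y <= pi -> cos y <= cos x.
Proof.
move=> xy yp; rewrite -(cos_norm x); move: xy; rewrite le_eqVlt => /predU1P[->//|xy].
have x0 := normr_ge0 x.
by apply/ltW; rewrite ltr_cos//; rewrite in_itv/=; apply/andP; split; lra.
Qed.

Lemma pair_series_gt0 (sigma theta t : R) : 1 < sigma -> 0 <= theta <= pi ->
  `|t| <= support_radius sigma ->
  0 < spline_hat (sigma + 1) theta * cos (theta * t) +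
    limn (series (pair_term (sigma + 1) theta t)).
Proof.
move=> s1 /andP[th0 thpi] tl.
have [c [/andP[c0 c1] c2 c3 /andP[l0 lh] lc]] := support_radius_cos _ s1.
set l := support_radius sigma in tl l0 lh lc; set s := sigma + 1.
have s2 : 2 <= s by rewrite /s; lra.
have s0 : 0 < s by lra.
have pi0 := pi_gt0 R.
have [th|thn0] := eqVneq theta 0.
  rewrite th mul0r cos0 mulr1 (_ : pair_term s 0 t = fun=> 0); last first.
    apply/funext => k; rewrite /pair_term subr0 addr0.
    have -> : spline_hat s (k.+1%:R * (2 * pi)) = 0.
      rewrite /spline_hat /sinc.
      have -> : k.+1%:R * (2 * pi) / 2 = 0 + k.+1%:R * pi :> R by field.
      have sn0 : sin (0 + k.+1%:R * pi : R) = 0.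
        by apply/eqP; rewrite -normr_eq0 sin_addn_pi sin0 normr0.
      have -> : (0 + k.+1%:R * pi == 0 :> R) = false.
        by rewrite add0r mulf_eq0 pnatr_eq0 (gt_eqF pi0).
      rewrite sn0 mul0r normr0 powR0//.
      by rewrite gt_eqF.
    by rewrite !mul0r addr0.
  rewrite (_ : series _ = fun=> 0); last by apply/funext => n; rewrite /series/= big1.
  rewrite lim_cst// addr0 /spline_hat /sinc mul0r eqxx normr1 powR1.
  exact: ltr01.
have {thn0 th0}th0 : 0 < theta by rewrite lt_neqAle eq_sym thn0.
have B0 : 0 < spline_hat s theta.
  rewrite /spline_hat /sinc gt_eqF ?divr_gt0//; apply: powR_gt0.
  rewrite normr_gt0 mulf_neq0 ?invr_eq0 ?gt_eqF ?divr_gt0//.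
  by apply: sin_gt0_pi; apply/andP; split; lra.
set B := spline_hat s theta in B0 *.
pose h : R := 2^-1 `^ s.
have h0 : 0 <= h by exact: powR_ge0.
pose r k : R := h * (k.+1%:R^-1 - k.+2%:R^-1).
pose rho w := (theta / w) `^ s.
have k2pi (k : nat) : 2 * pi <= k.+1%:R * (2 * pi) :> R.
  by rewrite ler_peMl// ?mulr_ge0 ?(ltW pi0)// ler1n.
have minus0 k : 0 < k.+1%:R * (2 * pi) - theta by have := k2pi k; lra.
have plusE k : spline_hat s (k.+1%:R * (2 * pi) + theta) =
    B * rho (k.+1%:R * (2 * pi) + theta).
  have p0 : 0 < k.+1%:R * (2 * pi) + theta by rewrite addr_gt0// !mulr_gt0.
  by rewrite (spline_hat_translate _ _ _ _ (erefl _)) ?gt_eqF// gtr0_norm.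
have minusE k : spline_hat s (k.+1%:R * (2 * pi) - theta) =
    B * rho (k.+1%:R * (2 * pi) - theta).
  rewrite (spline_hat_translate _ _ _ _ (erefl _)) ?oppr_eq0 ?gt_eqF//.
  by rewrite spline_hatN normrN gtr0_norm.
have rho0 w : 0 <= rho w by exact: powR_ge0.
have rho_le k w : (2 * k%:R + 3) * theta <= w -> rho w <= r k.
  move=> kw; have k0 := ler0n R k.
  have w0 : 0 < w by apply: lt_le_trans kw; rewrite mulr_gt0//; lra.
  apply: powR_inv_odd_le => //; first by rewrite divr_ge0// ltW.
  by rewrite mulrAC ler_pdivrMr// mul1r mulrC.
have plus_le k : rho (k.+1%:R * (2 * pi) + theta) <= r k.
  by apply: rho_le; have := ler0n R k; rewrite -natr1; nra.
(* The index is shifted by one: the frequency [2 * pi - theta] has no small ratio to [theta] and is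
   kept for the main term, so the minus terms are bounded only from the second pair on. *)
have minus_le k : rho (k.+2%:R * (2 * pi) - theta) <= r k.
  by apply: rho_le; have := ler0n R k; rewrite -[k.+2]addn2 natrD; nra.
(* The consecutive differences are [B * (r k + r k.+1)]. The tail is thus at most
   [a 0 = B * h * 3 / 2], and the plus term of the first pair adds [B * h / 2], for a total of
   [2 * B * h]. *)
pose a (k : nat) : R := B * (h * (k.+1%:R^-1 + k.+2%:R^-1)).
have a0 k : 0 <= a k.
  by apply: mulr_ge0; [exact: ltW|rewrite mulr_ge0// addr_ge0 ?invr_ge0].
have pa k : `|pair_term s theta t k.+1| <= a k - a k.+1.
  rewrite /pair_term plusE minusE.
  apply: (le_trans (ler_normD _ _)).
  have -> : a k - a k.+1 = B * r k.+1 + B * r k by rewrite /a /r; ring.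
  apply: lerD; rewrite !normrM (gtr0_norm B0) (ger0_norm (rho0 _)) -mulrA ler_wpM2l ?(ltW B0)//.
    by apply: le_trans (plus_le _); rewrite ler_piMr// cos_max.
  by apply: le_trans (minus_le _); rewrite ler_piMr// cos_max.
have [_ cv lim] := telescoping_series_bound _ _ pa a0.
have -> : limn (series (pair_term s theta t)) = pair_term s theta t 0%N +
    limn (series (fun k => pair_term s theta t k.+1)).
  apply/cvg_lim => //; rewrite -cvg_shiftS/=.
  under eq_fun do rewrite /series/= big_nat_recl//.
  by apply: cvgD; [exact: cvg_cst|exact: cv].
set T := limn _ in lim *.
have a00 : a 0%N = B * (h * (3 / 2)) by rewrite /a; congr (_ * (_ * _)); field.
rewrite a00 in lim.
rewrite /pair_term plusE minusE.
have p1 := plus_le 0%N; rewrite /r in p1.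
set w1 := 1 * (2 * pi) + theta in p1 *; set w2 := 1 * (2 * pi) - theta.
have w2E : w2 = 2 * pi - theta by rewrite /w2 mul1r.
have m1 : rho w2 <= 1.
  rewrite /rho -[leRHS](_ : 1 `^ s = 1); last by rewrite powR1.
  apply: ge0_ler_powR; rewrite ?nnegrE ?ler01 ?divr_ge0 ?(ltW s0) ?(ltW th0)//.
    by rewrite w2E; lra.
  by rewrite ler_pdivrMr w2E; lra.
have pl : pi * l <= pi by rewrite ler_piMr ?(ltW pi0)//; lra.
have ctheta : c <= cos (theta * t).
  rewrite -lc; apply: cos_ge_of_le => //.
  by rewrite normrM gtr0_norm// ler_pM// ltW.
have cpi : c <= cos (pi * t).
  rewrite -lc; apply: cos_ge_of_le => //.
  by rewrite normrM gtr0_norm// ler_pM2l.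
have cpith : c <= cos ((pi - theta) * t).
  rewrite -lc; apply: cos_ge_of_le => //.
  rewrite normrM ger0_norm; last by lra.
  by rewrite ler_pM//; lra.
have sumcos : cos (theta * t) + cos (w2 * t) = 2 * (cos (pi * t) * cos ((pi - theta) * t)).
  rewrite cosM mulrA divff// mul1r addrC w2E; congr (cos _ + cos _); ring.
have hc : h = c ^+ 3 by rewrite c3.
(* If the second cosine is nonnegative, the first alone is at least [c > 2 * c ^ 3]. Otherwise
   [rho w2 <= 1] allows its coefficient to be replaced by 1, and the sum of cosines is at least
   [2 * c ^ 2 > 2 * c ^ 3]. *)
have main : 2 * h < cos (theta * t) + rho w2 * cos (w2 * t).
  rewrite hc; have [x2|x2] := leP 0 (cos (w2 * t)).
    have : 0 <= rho w2 * cos (w2 * t) by rewrite mulr_ge0.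
    by nra.
  have : cos (w2 * t) <= rho w2 * cos (w2 * t) by nra.
  have : c * c <= cos (pi * t) * cos ((pi - theta) * t) by rewrite ler_pM// ltW.
  by nra.
have q1 : - (h * 2^-1) <= rho w1 * cos (w1 * t).
  have : `|rho w1 * cos (w1 * t)| <= h * 2^-1.
    rewrite normrM (ger0_norm (rho0 _)).
    apply: (@le_trans _ _ (rho w1 * 1)); first by rewrite ler_wpM2l// cos_max.
    by rewrite mulr1 (le_trans p1)//; lra.
  by rewrite ler_norml => /andP[].
move: lim; rewrite ler_norml => /andP[lim _].
have := mulr_gt0 B0 (_ : 0 < cos (theta * t) + rho w2 * cos (w2 * t) - 2 * h).
rewrite subr_gt0 => /(_ main).
have := ler_wpM2l (ltW B0) q1.
lra.
Qed.

End Positivity.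

(** * Strict positivity of an integral *)

Section PositiveIntegral.
Context {R : realType}.
Local Notation mu := (@lebesgue_measure R).

(** A nonnegative function with nonpositive integral is null almost everywhere, and its zeros are
    zeros of [k]. No uniform lower bound on the ratio of [f] to [k] is required. *)
Lemma Rintegral_gt0_ae (f k : R -> R) : L1 f -> L1 k ->
  {ae mu, forall t, 0 <= f t /\ (f t = 0 -> k t = 0)} ->
  0 < \int[mu]_t k t -> 0 < \int[mu]_t f t.
Proof.
move=> lf lk fk; apply: contraTT; rewrite -!leNgt => f0.
have mf := L1_measurable _ lf; have mk := L1_measurable _ lk.
have lnf := L1_norm _ lf; have mnf := L1_measurable _ lnf.
have fE : \int[mu]_t f t = \int[mu]_t `|f t|.
  by apply: Rintegral_ae => //; move: fk; apply: ae_imply => t [f1 _]; rewrite ger0_norm.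
have nf0 : \int[mu]_t `|f t| = 0.
  by apply/eqP; rewrite eq_le -{1}fE f0/=; apply: Rintegral_ge0 => t _.
have fae : ae_eq mu setT (EFin \o f) (cst 0%E).
  apply/ae_eq_integral_abs => //; first exact/measurable_EFinP.
  by rewrite -[LHS]fineK; [rewrite -[fine _]/(\int[mu]_t `|f t|) nf0|exact: integrable_fin_num].
rewrite (_ : \int[mu]_t k t = \int[mu]_t 0); first by rewrite Rintegral_cst// mul0r.
apply: Rintegral_ae => //; move: fk fae; apply: ae_imply2 => t [_ fk] ft.
by apply: fk; have [] := ft I.
Qed.

End PositiveIntegral.

(** * Twisted periodization and samples of the convolution *)

Section TwistedSum.
Context {R : realType}.
Implicit Types (t p w theta : R).
Local Notation mu := (@lebesgue_measure R).
Context (b : R -> R) (C s : R) (s2 : 2 <= s) (lb : L1 b).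
Context (bC : forall t, `|b t| <= C / (1 + t ^+ 2)).
Context (hb : forall w p,
  \int[mu]_t (b t * cos (w * t + p)) = spline_hat s w * cos p).

Lemma spline_hat_progression_le theta (k : nat) : `|theta| <= pi ->
  `|spline_hat s (k.+1%:R * (2 * pi) + theta)| <= 8 * (1 + k%:R ^+ 2)^-1.
Proof.
rewrite ler_norml => /andP[t1 t2]; have pi2 := pi_ge2 R; have k0 := ler0n R k.
apply: (le_trans (spline_hat_bound s s2 _)); rewrite ler_wpM2l//.
have kw : k%:R <= k.+1%:R * (2 * pi) + theta by rewrite -natr1; nra.
have p1 (y : R) : 0 < 1 + y ^+ 2 by have := sqr_ge0 y; lra.
rewrite lef_pV2 ?posrE// lerD2l ler_sqr ?nnegrE//.
exact: le_trans kw.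
Qed.

Lemma summable_le (u : nat -> R) (K : R) :
  (forall n, `|u n| <= K * (1 + n%:R ^+ 2)^-1) -> cvgn (series (fun n => `|u n|)).
Proof.
move=> uK; apply: (series_le_cvg _ _ uK) => //.
  by move=> n; exact: le_trans (uK n).
exact: (is_cvg_seriesZ (k := K) summable_inv_oneDsqr).
Qed.

Lemma decay_mul_le (g : R -> R) : (forall t, `|g t| <= 1) ->
  forall t, `|b t * g t| <= C / (1 + t ^+ 2).
Proof. by move=> g1 t; rewrite normrM (le_trans _ (bC t))// ler_piMr. Qed.

Lemma integral_cos_cos theta w p :
  \int[mu]_t (b t * cos (theta * t) * cos (w * t + p)) =
  2^-1 * (spline_hat s (w + theta) + spline_hat s (w - theta)) * cos p.
Proof.
have lc (x y : R) : L1 (fun t => b t * cos (x * t + y)) by exact: L1_cos_affine.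
transitivity (\int[mu]_t (2^-1 * (b t * cos ((w + theta) * t + p)) +
  2^-1 * (b t * cos ((w - theta) * t + p)))).
  apply: Rintegral_ext => t.
  have -> : (w + theta) * t + p = w * t + p + theta * t by ring.
  have -> : (w - theta) * t + p = w * t + p - theta * t by ring.
  by rewrite (cosD (w * t + p)) (cosB (w * t + p)); field.
rewrite RintegralD//; [|exact/L1Z/lc..].
by rewrite (RintegralZl _ measurableT (lc _ _)) (RintegralZl _ measurableT (lc _ _)) !hb; ring.
Qed.

(** The factor is left as [cos (p - - (pi / 2))] to match the common phase [q = - (pi / 2)] of a
    sine series in [harmonic_sum]. *)
Lemma integral_sin_cos theta w p :
  \int[mu]_t (b t * sin (theta * t) * cos (w * t + p)) =
  2^-1 * (spline_hat s (w - theta) - spline_hat s (w + theta)) * cos (p - - (pi / 2)).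
Proof.
have lc (x y : R) : L1 (fun t => b t * cos (x * t + y)) by exact: L1_cos_affine.
rewrite opprK cosDpihalf.
transitivity (\int[mu]_t (2^-1 * (b t * cos ((w + theta) * t + (p - pi / 2))) -
  2^-1 * (b t * cos ((w - theta) * t + (p - pi / 2))))).
  apply: Rintegral_ext => t.
  have -> : (w + theta) * t + (p - pi / 2) = w * t + p + theta * t - pi / 2 by ring.
  have -> : (w - theta) * t + (p - pi / 2) = w * t + p - theta * t - pi / 2 by ring.
  by rewrite !cosBpihalf (sinD (w * t + p)) (sinB (w * t + p)); field.
rewrite RintegralB//; [|exact/L1Z/lc..].
rewrite (RintegralZl _ measurableT (lc _ _)) (RintegralZl _ measurableT (lc _ _)) !hb.
by rewrite cosBpihalf; ring.
Qed.

Definition twisted_translates theta t (n : nat) : R :=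
  b (t + n%:R) * cos (n%:R * theta) + b (t - n.+1%:R) * cos (n.+1%:R * theta).

(** Writing [m * theta = theta * (t + m) - theta * t] splits the sum into periodizations of [b]
    modulated by [cos (theta * t)] and by [sin (theta * t)]. Poisson summation applies to each, and
    the addition formulas recombine the two series. *)
Lemma twisted_periodization theta : 0 <= theta <= pi ->
  {ae mu, forall t, `|t| < 2^-1 ->
    limn (series (twisted_translates theta t)) =
    spline_hat s theta * cos (theta * t) + limn (series (pair_term s theta t))}.
Proof.
move=> /andP[th0 thpi].
have mcos : measurable_fun setT (fun t => cos (theta * t)).
  by have := measurable_cos_affine theta 0; under eq_fun do rewrite addr0.
have msin : measurable_fun setT (fun t => sin (theta * t)).
  have := measurable_cos_affine theta (- (pi / 2)).
  by under eq_fun do rewrite cosBpihalf.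
have lc : L1 (fun t => b t * cos (theta * t)).
  by apply: (L1Mb _ _ 1) => // t; exact: cos_max.
have ls : L1 (fun t => b t * sin (theta * t)).
  by apply: (L1Mb _ _ 1) => // t; exact: sin_max.
have dc := decay_mul_le (fun t => cos (theta * t)) (fun t => cos_max _).
have ds := decay_mul_le (fun t => sin (theta * t)) (fun t => sin_max _).
have thn : `|theta| <= pi by rewrite ger0_norm.
have thn' : `|- theta| <= pi by rewrite normrN.
pose plus k := spline_hat s (k.+1%:R * (2 * pi) + theta).
pose minus k := spline_hat s (k.+1%:R * (2 * pi) - theta).
pose cc k := 2^-1 * (plus k + minus k).
pose cs k := 2^-1 * (minus k - plus k).
have ccb k : `|cc k| <= 8 * (1 + k%:R ^+ 2)^-1.
  have h1 := spline_hat_progression_le theta k thn.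
  have h2 := spline_hat_progression_le (- theta) k thn'.
  rewrite /cc normrM ger0_norm ?invr_ge0//.
  by have := ler_normD (plus k) (minus k); rewrite /plus /minus in h1 h2 *; lra.
have csb k : `|cs k| <= 8 * (1 + k%:R ^+ 2)^-1.
  have h1 := spline_hat_progression_le theta k thn.
  have h2 := spline_hat_progression_le (- theta) k thn'.
  rewrite /cs normrM ger0_norm ?invr_ge0//.
  by have := ler_normB (minus k) (plus k); rewrite /plus /minus in h1 h2 *; lra.
have sc := summable_le _ _ ccb; have ss := summable_le _ _ csb.
have ic0 : \int[mu]_t (b t * cos (theta * t)) = spline_hat s theta.
  by have := hb theta 0; under Rintegral_ext do rewrite addr0; rewrite cos0 mulr1.
have is0 : \int[mu]_t (b t * sin (theta * t)) = 0.
  have := hb theta (- (pi / 2)); under Rintegral_ext do rewrite cosBpihalf.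
  by rewrite cosN cos_pihalf mulr0.
have Pc := periodization_fourier _ C _ cc 0 lc dc sc ic0
  (fun k p => ltac:(by rewrite divr1 integral_cos_cos subr0)).
have Ps := periodization_fourier _ C _ cs (- (pi / 2)) ls ds ss is0
  (fun k p => ltac:(by rewrite divr1 integral_sin_cos)).
apply: ae_imply2 Pc Ps => t Pc Ps th.
have {}Pc := Pc th; have {}Ps := Ps th.
have th' := ltW th.
have cvc := periodization_cvg _ _ _ dc th'.
have cvs := periodization_cvg _ _ _ ds th'.
have -> : limn (series (twisted_translates theta t)) =
    cos (theta * t) * periodization (fun t => b t * cos (theta * t)) t +
    sin (theta * t) * periodization (fun t => b t * sin (theta * t)) t.
  rewrite /periodization.
  rewrite (_ : twisted_translates theta t =
    cos (theta * t) *: translates (fun t => b t * cos (theta * t)) t +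
    sin (theta * t) *: translates (fun t => b t * sin (theta * t)) t); last first.
    apply/funext => n.
    transitivity (cos (theta * t) * translates (fun t => b t * cos (theta * t)) t n +
      sin (theta * t) * translates (fun t => b t * sin (theta * t)) t n); last by [].
    rewrite /twisted_translates /translates.
    have -> : n%:R * theta = theta * (t + n%:R) - theta * t by ring.
    have -> : cos (n.+1%:R * theta) = cos (theta * (t - n.+1%:R) - theta * t).
      by rewrite -cosN; congr cos; ring.
    by rewrite !cosB; ring.
  rewrite lim_seriesD; [|exact: is_cvg_seriesZ..].
  by rewrite !lim_seriesZ.
rewrite Pc Ps /harmonic_sum.
have bnd_cvg (c : nat -> R) (q : R) : cvgn (series (fun k => `|c k|)) ->
    cvgn (series (fun k => c k * cos (k.+1%:R * (2 * pi / 1) * t + q))).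
  move=> cv; apply: normed_cvg => /=; apply: series_le_cvg cv => k //=.
  by rewrite normrM ler_piMr// cos_max.
have cv1 := bnd_cvg _ 0 sc; have cv2 := bnd_cvg _ (- (pi / 2)) ss.
have -> : limn (series (pair_term s theta t)) =
    2 * cos (theta * t) * limn (series (fun k => cc k * cos (k.+1%:R * (2 * pi / 1) * t + 0))) +
    2 * sin (theta * t) * limn (series (fun k =>
      cs k * cos (k.+1%:R * (2 * pi / 1) * t + - (pi / 2)))).
  rewrite (_ : pair_term s theta t =
    (2 * cos (theta * t)) *: (fun k => cc k * cos (k.+1%:R * (2 * pi / 1) * t + 0)) +
    (2 * sin (theta * t)) *: (fun k =>
      cs k * cos (k.+1%:R * (2 * pi / 1) * t + - (pi / 2)))); last first.
    apply/funext => k.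
    transitivity ((2 * cos (theta * t)) * (cc k * cos (k.+1%:R * (2 * pi / 1) * t + 0)) +
      (2 * sin (theta * t)) * (cs k * cos (k.+1%:R * (2 * pi / 1) * t + - (pi / 2)))); last by [].
    rewrite /pair_term /cc /cs /plus /minus addr0 divr1 cosBpihalf.
    rewrite [(k.+1%:R * (2 * pi) + theta) * t]mulrDl [(k.+1%:R * (2 * pi) - theta) * t]mulrBl.
    by rewrite cosD cosB; field.
  rewrite lim_seriesD; [|exact: is_cvg_seriesZ..].
  by rewrite !lim_seriesZ.
by rewrite invr1; ring.
Qed.

Context (k : R -> R) (l : R) (lk : L1 k) (k0 : forall t, 0 <= k t).
Context (l2 : l < 2^-1) (ksupp : forall t, l < `|t| -> k t = 0).

(** With [k t = h (- t)] this is the convolution of [b] and [h] at [x], in a form where the sum over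
    [x] acts on translates of [b] under a fixed weight. *)
Definition sampled (x : R) : R := \int[mu]_t (k t * b (t + x)).

Lemma L1_sampled x : L1 (fun t => k t * b (t + x)).
Proof.
apply: (L1Mb _ _ C) => //.
  exact: (measurable_shift _ _ (L1_measurable _ lb)).
move=> t; apply: (le_trans (bC _)).
have C0 : 0 <= C by have := bC 0; rewrite expr0n addr0 divr1; apply: le_trans.
rewrite ler_piMr// invf_le1//; have := sqr_ge0 (t + x); lra.
Qed.

Lemma norm_sampled x : `|sampled x| <= 4 * C * (\int[mu]_t k t) / (1 + x ^+ 2).
Proof.
rewrite (le_trans (le_normr_Rintegral _ _))//; first exact: L1_sampled.
have -> : 4 * C * (\int[mu]_t k t) / (1 + x ^+ 2) =
    \int[mu]_t (4 * C / (1 + x ^+ 2) * k t) by rewrite RintegralZl//; ring.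
apply: le_Rintegral => //; [exact/L1_norm/L1_sampled|exact: L1Z|].
move=> t _; rewrite normrM mulrC (ger0_norm (k0 t)).
have [lt|tl] := ltP l `|t|; first by rewrite ksupp// !mulr0.
apply: ler_wpM2r => //; apply: decay_translate => //.
by apply: (le_trans tl); exact: ltW.
Qed.

Lemma sampled_sum theta : 0 <= theta <= pi ->
  let u n := sampled n%:R * cos (n%:R * theta) +
    sampled (- n.+1%:R) * cos (n.+1%:R * theta) in
  series u @ \oo -->
    \int[mu]_t (k t * limn (series (twisted_translates theta t))) /\
  L1 (fun t => k t * limn (series (twisted_translates theta t))).
Proof.
move=> thpi u.
pose f_ n t := k t * twisted_translates theta t n.
have E n t : f_ n t = cos (n%:R * theta) * (k t * b (t + n%:R)) +
    cos (n.+1%:R * theta) * (k t * b (t + - n.+1%:R)).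
  by rewrite /f_ /twisted_translates; ring.
have lf n : L1 (f_ n).
  by apply: (L1_ext _ _ (fun t => esym (E n t))); apply: L1D; exact/L1Z/L1_sampled.
have fb n t : `|f_ n t| <= (8 * C * (1 + n%:R ^+ 2)^-1) * k t.
  rewrite /f_ normrM mulrC (ger0_norm (k0 t)).
  have [lt|tl] := ltP l `|t|; first by rewrite ksupp// !mulr0.
  rewrite ler_wpM2r// /twisted_translates (le_trans (ler_normD _ _))//.
  have th : `|t| <= 2^-1 by exact: le_trans tl (ltW l2).
  have C0 : 0 <= C by have := bC 0; rewrite expr0n addr0 divr1; apply: le_trans.
  have h1 := decay_translate _ _ _ n%:R bC th.
  have h2 := decay_translate _ _ _ (- n.+1%:R) bC th.
  have h3 : (1 + (- n.+1%:R) ^+ 2)^-1 <= (1 + n%:R ^+ 2)^-1 :> R.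
    have p1 (y : R) : 0 < 1 + y ^+ 2 by have := sqr_ge0 y; lra.
    rewrite lef_pV2 ?posrE//.
    by rewrite sqrrN lerD2l ler_sqr ?nnegrE// ler_nat.
  have h4 : 4 * C * (1 + (- n.+1%:R) ^+ 2)^-1 <= 4 * C * (1 + n%:R ^+ 2)^-1.
    by rewrite ler_wpM2l// mulr_ge0.
  have c1 (x y : R) : `|x * cos y| <= `|x| by rewrite normrM ler_piMr// cos_max.
  have := c1 (b (t + n%:R)) (n%:R * theta).
  by have := c1 (b (t - n.+1%:R)) (n.+1%:R * theta); lra.
have cc : cvgn (series (fun n => 8 * C * (1 + n%:R ^+ 2)^-1)).
  exact: (is_cvg_seriesZ (k := 8 * C) summable_inv_oneDsqr).
have [fcv l1 lim1] := Rintegral_series f_ _ _ (fun n => L1_measurable _ (lf n)) lk cc k0 fb.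
have limE t : limn (series (f_ ^~ t)) = k t * limn (series (twisted_translates theta t)).
  have [kt|kt] := eqVneq (k t) 0.
    rewrite kt mul0r (_ : f_ ^~ t = fun=> 0); last by apply/funext => n; rewrite /f_ kt mul0r.
    by rewrite (_ : series _ = fun=> 0) ?lim_cst//; apply/funext => n; rewrite /series/= big1.
  have cv : cvgn (series (twisted_translates theta t)).
    have := is_cvg_seriesZ (k := (k t)^-1) (fcv t).
    rewrite (_ : _ *: _ = twisted_translates theta t)//.
    apply/funext => n; transitivity ((k t)^-1 * f_ n t); first by [].
    by rewrite /f_ mulrA mulVf// mul1r.
  exact: (lim_seriesZ (k t) cv).
split; last by apply: L1_ext l1.
have uE n : \int[mu]_t f_ n t = u n.
  under Rintegral_ext do rewrite E.
  rewrite RintegralD//; [|exact/L1Z/L1_sampled..].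
  rewrite !RintegralZl//; [|exact: L1_sampled..].
  by rewrite /u /sampled; ring.
rewrite -(funext uE); under [X in _ --> X]Rintegral_ext do rewrite -limE.
exact: lim1.
Qed.

Lemma sampled_sum_gt0 (sigma theta : R) : s = sigma + 1 -> 1 < sigma ->
  l = support_radius sigma -> 0 <= theta <= pi -> 0 < \int[mu]_t k t ->
  0 < \int[mu]_t (k t * limn (series (twisted_translates theta t))).
Proof.
move=> sE s1 lE thpi kpos.
have [_ lW] := sampled_sum theta thpi.
apply: (Rintegral_gt0_ae _ k) => //.
have := twisted_periodization theta thpi; apply: ae_imply => t W.
have [lt|tl] := ltP l `|t|; first by rewrite ksupp// mul0r.
rewrite W; last exact: le_lt_trans l2.
rewrite lE in tl.
have := pair_series_gt0 sigma theta t s1 thpi tl; rewrite -sE => S0.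
split; first by rewrite mulr_ge0// ltW.
by move=> /eqP; rewrite mulf_eq0 (gt_eqF S0) orbF => /eqP.
Qed.

End TwistedSum.

(** * Complex series *)

Section ComplexSeries.
Context {R : realType}.

Lemma numField_cvgP (K : numFieldType) (u : nat -> K) (l : K) :
  (forall e, 0 < e -> \forall n \near \oo, `|l - u n| < e) ->
  cvgn u /\ limn u = l.
Proof.
move=> H; have ul : u @ \oo --> l by apply/cvgrPdist_lt.
by split; [apply/cvg_ex; exists l|exact: cvg_lim].
Qed.

Lemma complex_cvg (u : nat -> R[i]) (a b : R) :
  (fun n => complex.Re (u n)) @ \oo --> a ->
  (fun n => complex.Im (u n)) @ \oo --> b ->
  let K : numFieldType := R[i] in
  cvgn (u : nat -> K) /\ limn (u : nat -> K) = a +i* b.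
Proof.
move=> /cvgrPdist_lt ua /cvgrPdist_lt ub K.
(* In the order of [R[i]] a positive tolerance has zero imaginary part, so it reduces to the real
   number [e]. *)
apply: numField_cvgP => -[e e']; rewrite ltcE/= => /andP[/eqP -> e0].
have e2 : 0 < e / 2 by rewrite divr_gt0.
have na := ua _ e2; have nb := ub _ e2.
near=> n.
have an : `|a - complex.Re (u n)| < e / 2 by near: n; exact: na.
have bn : `|b - complex.Im (u n)| < e / 2 by near: n; exact: nb.
case: (u n) an bn => x y /= an bn.
rewrite normc_def/= ltcR; apply: (@le_lt_trans _ _ (`|a - x| + `|b - y|)); last by lra.
have s0 : 0 <= `|a - x| + `|b - y| by rewrite addr_ge0.
rewrite -(ger0_norm s0) -sqrtr_sqr ler_wsqrtr// [leRHS]sqrrD.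
rewrite [`|a - x| ^+ 2]real_normK ?num_real// [`|b - y| ^+ 2]real_normK ?num_real//.
have := mulr_ge0 (normr_ge0 (a - x)) (normr_ge0 (b - y)).
by rewrite -mulr_natr; lra.
Unshelve. all: by end_near. Qed.

Lemma Re_series (u : nat -> R[i]) n :
  complex.Re (series u n) = series (fun m => complex.Re (u m)) n.
Proof.
rewrite /series/=; elim: n => [|n IHn]; first by rewrite !big_geq.
by rewrite !big_nat_recr//= -IHn; case: (\sum_(_ <= _ < _) _) (u n) => [? ?] [].
Qed.

Lemma Im_series (u : nat -> R[i]) n :
  complex.Im (series u n) = series (fun m => complex.Im (u m)) n.
Proof.
rewrite /series/=; elim: n => [|n IHn]; first by rewrite !big_geq.
by rewrite !big_nat_recr//= -IHn; case: (\sum_(_ <= _ < _) _) (u n) => [? ?] [].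
Qed.

Lemma complex_series_cvg (u : nat -> R[i]) :
  cvgn (series (fun n => complex.Re (u n))) ->
  cvgn (series (fun n => complex.Im (u n))) ->
  let K : numFieldType := R[i] in
  cvgn (series (u : nat -> K)) /\
  complex.Re (limn (series (u : nat -> K))) = limn (series (fun n => complex.Re (u n))).
Proof.
move=> cr ci K.
have hr : (fun n => complex.Re (series u n)) @ \oo -->
    limn (series (fun n => complex.Re (u n))) by rewrite (funext (Re_series u)).
have hi : (fun n => complex.Im (series u n)) @ \oo -->
    limn (series (fun n => complex.Im (u n))) by rewrite (funext (Im_series u)).
have [c e] := @complex_cvg (series u) _ _ hr hi.
split; first exact: c.
by rewrite e.
Qed.

(** The sign [sg] selects the upper or lower half circle, so that [theta] stays in [[0, pi]]. *)
Definition arc_point (theta sg : R) : R[i] := cos theta +i* (sg * sin theta).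

Lemma unit_circle_param (z : R[i]) : `|z| = 1 ->
  exists theta sg, [/\ 0 <= theta <= pi, sg ^+ 2 = 1 & z = arc_point theta sg].
Proof.
case: z => x y; rewrite normc_def/= => /complexI h1.
have xy : x ^+ 2 + y ^+ 2 = 1.
  rewrite -[LHS]sqr_sqrtr; last by rewrite addr_ge0 ?sqr_ge0.
  by rewrite h1 expr1n.
have xin : -1 <= x <= 1.
  by have := sqr_ge0 y; move=> y0; apply/andP; split; nra.
exists (acos x), (if 0 <= y then 1 else -1); split.
- by rewrite acos_ge0// acos_lepi.
- by case: ifP => _; rewrite ?sqrrN expr1n.
- rewrite /arc_point acosK ?in_itv// sin_acos//.
  have -> : 1 - x ^+ 2 = y ^+ 2 by rewrite -xy; ring.
  rewrite sqrtr_sqr; case: ifPn => y0; first by rewrite mul1r ger0_norm.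
  by rewrite mulN1r ltr0_norm ?opprK// ltNge.
Qed.

Lemma arc_pointX (theta sg : R) n : sg ^+ 2 = 1 ->
  arc_point theta sg ^+ n = arc_point (n%:R * theta) sg.
Proof.
move=> sg2; elim: n => [|n IHn].
  by rewrite expr0 /arc_point mul0r cos0 sin0 mulr0.
rewrite exprS IHn /arc_point -natr1 mulrDl mul1r cosD sinD.
by apply/eqP; rewrite eq_complex/=; apply/andP; split; apply/eqP; ring: sg2.
Qed.

Lemma arc_pointV (theta sg : R) : sg ^+ 2 = 1 ->
  (arc_point theta sg)^-1 = arc_point theta (- sg).
Proof.
move=> sg2; have h : arc_point theta sg * arc_point theta (- sg) = 1.
  apply/eqP; rewrite eq_complex/=; apply/andP; split; apply/eqP; last by ring.
  rewrite -(cos2Dsin2 theta).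
  by transitivity (cos theta ^+ 2 + sg ^+ 2 * sin theta ^+ 2); [ring|rewrite sg2 mul1r].
exact: mulr1_eq h.
Qed.

End ComplexSeries.

(** * From the spline and the averaging function to the theorem *)

Section Assembly.
Context {R : realType}.
Implicit Types (beta h b k : R -> R).
Local Notation mu := (@lebesgue_measure R).

(** The prescribed transform is real, so the sine integral vanishes and only the [cos p] part of the
    addition formula survives. *)
Lemma bspline_cos_transform (sigma : R) beta : is_fractional_bspline sigma beta ->
  forall w p, \int[mu]_t (beta t * cos (w * t + p)) =
    spline_hat (sigma + 1) w * cos p.
Proof.
move=> [/Lfun1_integrable lb _ ft] w p.
have := ft w; rewrite /fourier /Cintegral.
under Rintegral_ext do rewrite /= mul0r subr0 cosN.
under [X in _ +i* X]Rintegral_ext do rewrite /= mul0r addr0 sinN.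
move=> [re im].
have lc : L1 (fun t => beta t * cos (w * t)).
  by have := L1_cos_affine beta w 0 lb; under eq_fun do rewrite addr0.
have lsN : L1 (fun t => beta t * - sin (w * t)).
  have := L1N _ (L1_cos_affine beta w (- (pi / 2)) lb).
  by under eq_fun do rewrite cosBpihalf -mulrN.
transitivity (\int[mu]_t (cos p * (beta t * cos (w * t)) +
    sin p * (beta t * - sin (w * t)))).
  by apply: Rintegral_ext => t; rewrite cosD; ring.
rewrite RintegralD//; [|exact: L1Z..].
by rewrite !RintegralZl// re im mulr0 addr0 mulrC.
Qed.

Lemma convolution_sampled beta h b k (C : R) : L1 b ->
  (forall t, `|b t| <= C) -> measurable_fun setT beta -> L1 h -> L1 k ->
  {ae mu, forall t, beta t = b t} -> {ae mu, forall t, h t = k (- t)} ->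
  forall x, convolution beta h x = sampled b k x.
Proof.
move=> lb bC mbeta lh lk betab hk x; rewrite /convolution /sampled.
have mb := L1_measurable _ lb; have mh := L1_measurable _ lh.
have [lhx _] := Rintegral_reflect _ x lh.
have [lkN _] := Rintegral_opp _ lk.
transitivity (\int[mu]_t (b t * h (x - t))).
  apply: Rintegral_ae; last by move: betab; apply: ae_imply => t ->.
    exact: measurable_funM mbeta (L1_measurable _ lhx).
  exact: measurable_funM mb (L1_measurable _ lhx).
have [lbN _] := Rintegral_reflect _ x lb.
have mbN := L1_measurable _ lbN.
have lF : L1 (fun t => h t * b (x - t)) by exact: (L1Mb _ _ C).
have lG : L1 (fun t => k t * b (t + x)).
  apply: (L1Mb _ _ C) => //.
  exact: measurable_shift.
have [lGN <-] := Rintegral_opp _ lG.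
transitivity (\int[mu]_t (h t * b (x - t))).
  have [_ <-] := Rintegral_reflect _ x lF.
  by apply: Rintegral_ext => t; rewrite subKr mulrC.
apply: Rintegral_ae; [exact: L1_measurable|exact: L1_measurable|].
by move: hk; apply: ae_imply => t ->; rewrite addrC.
Qed.

(** Setting [beta] to 0 where the bound fails makes the decay hold at every point, so the series of
    translates converge everywhere on the unit cell. *)
Lemma decaying_representative beta (C : R) : L1 beta ->
  {ae mu, forall t, `|beta t| <= C / (1 + t ^+ 2)} -> 0 <= C ->
  exists b, [/\ L1 b, forall t, `|b t| <= C / (1 + t ^+ 2) &
    {ae mu, forall t, beta t = b t}].
Proof.
move=> lb bC C0; have mb := L1_measurable _ lb.
pose P t := `|beta t| * (1 + t ^+ 2) <= C.
have p1 (t : R) : 0 < 1 + t ^+ 2 by have := sqr_ge0 t; lra.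
have PE t : P t = (`|beta t| <= C / (1 + t ^+ 2)) by rewrite ler_pdivlMr.
have mP : measurable_fun setT (fun t => (P t)%:R : R).
  apply: measurable_bool_indicator; apply: measurable_fun_ler => //.
  apply: measurable_funM; first by apply: measurableT_comp.
  by apply: measurable_funD => //; apply: measurable_funX.
exists (fun t => beta t * (P t)%:R); split.
- by apply: (L1Mb _ _ 1) => // t; rewrite normr_nat lern1 leq_b1.
- move=> t; rewrite normrM normr_nat; have [h|h] := boolP (P t).
    by rewrite mulr1 -PE.
  by rewrite mulr0 divr_ge0// ltW.
- by move: bC; apply: ae_imply => t; rewrite -PE => ->; rewrite mulr1.
Qed.

(** Sign and support are enforced pointwise by cutting [h] off on a null set before reflecting it. A
    zero integral would force [h] to be null, which is excluded. *)
Lemma positive_reflection h (l : R) : L1 h ->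
  {ae mu, forall t, 0 <= h t} ->
  {ae mu, forall t, ~ (- l <= t <= l) -> h t = 0} ->
  ~ {ae mu, forall t, h t = 0} ->
  exists k, [/\ L1 k, forall t, 0 <= k t, forall t, l < `|t| -> k t = 0,
    {ae mu, forall t, h t = k (- t)} & 0 < \int[mu]_t k t].
Proof.
move=> lh h0 hsupp hn0; have mh := L1_measurable _ lh.
pose P t := (0 <= h t) && (`|t| <= l).
have mP : measurable_fun setT (fun t => (P t)%:R : R).
  apply: measurable_bool_indicator; apply: measurable_and.
    exact: measurable_fun_ler.
  by apply: measurable_fun_ler => //; exact: measurableT_comp.
pose h' t := h t * (P t)%:R.
have lh' : L1 h' by apply: (L1Mb _ _ 1) => // t; rewrite normr_nat lern1 leq_b1.
have hh' : {ae mu, forall t, h t = h' t}.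
  apply: ae_imply2 h0 hsupp => t ht tl; rewrite /h' /P ht/= ler_norml.
  by have [tl'|/negP/tl ->] := boolP (- l <= t <= l); rewrite ?mulr1 ?mul0r.
have h'0 t : 0 <= h' t.
  by rewrite /h' /P; case: (leP 0 (h t)) => h1; [exact: mulr_ge0|rewrite mulr0].
have [lk ik] := Rintegral_opp _ lh'.
exists (fun t => h' (- t)); split => //.
- by move=> t lt; rewrite /h' /P normrN [_ <= l]leNgt lt andbF mulr0.
- by move: hh'; apply: ae_imply => t ->; rewrite opprK.
rewrite ik lt_neqAle Rintegral_ge0// andbT eq_sym; apply/negP => /eqP i0.
apply: hn0.
have h'ae : ae_eq mu setT (EFin \o h') (cst 0%E).
  apply/ae_eq_integral_abs => //; first by apply/measurable_EFinP; exact: L1_measurable.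
  under eq_integral do rewrite /= ger0_norm//.
  by rewrite -[LHS]fineK; [rewrite -[fine _]/(\int[mu]_t h' t) i0|exact: integrable_fin_num].
by move: hh' h'ae; apply: ae_imply2 => t -> ht; have [] := ht I.
Qed.

End Assembly.

(** The hypothesis [h_neq0] excludes the null averaging function, for which [G] is identically 0.
    Convergence is part of the conclusion because it gives [G] its meaning. *)
Theorem theorem3p1 (R : realType) (sigma : R) (beta h : R -> R)
    (sigma_gt1 : 1 < sigma)
    (beta_spline : is_fractional_bspline sigma beta)
    (h_L1 : h \in Lfun (@lebesgue_measure R) 1)
    (h_ge0 : {ae (@lebesgue_measure R), forall t, 0 <= h t})
    (h_supp : {ae (@lebesgue_measure R), forall t,
        ~ (- support_radius sigma <= t <= support_radius sigma) -> h t = 0})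
    (h_neq0 : ~ {ae (@lebesgue_measure R), forall t, h t = 0}) :
  forall z : R[i], `|z| = 1 ->
    bilateral_cvg (Gterm beta h z) /\ G beta h z <> 0.
Proof.
move=> z /unit_circle_param[theta [sg [thpi sg2 ->]]] {z}.
have lbeta : L1 beta by case: beta_spline => /Lfun1_integrable.
have lh : L1 h by exact/Lfun1_integrable.
have s2 : 2 <= sigma + 1 by lra.
have hbeta := bspline_cos_transform _ _ beta_spline.
have [C C0 betaC] := spline_decay _ _ s2 lbeta hbeta.
have [b [lb bC betab]] := decaying_representative _ _ lbeta betaC C0.
have mbeta := L1_measurable _ lbeta; have mb := L1_measurable _ lb.
have hb w p : \int[lebesgue_measure]_t (b t * cos (w * t + p)) =
    spline_hat (sigma + 1) w * cos p.
  rewrite -hbeta; apply: Rintegral_ae.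
  - exact: (L1_measurable _ (L1_cos_affine _ _ _ lb)).
  - exact: (L1_measurable _ (L1_cos_affine _ _ _ lbeta)).
  - by move: betab; apply: ae_imply => t ->.
have [k [lk k0 ksupp hk kpos]] := positive_reflection _ _ lh h_ge0 h_supp h_neq0.
have [c [_ _ _ /andP[_ l2] _]] := support_radius_cos _ sigma_gt1.
have bb t : `|b t| <= C.
  rewrite (le_trans (bC t))// ler_piMr// invf_le1//; have := sqr_ge0 t; lra.
have convE := convolution_sampled beta h b k C lb bb mbeta lh lk betab hk.
pose A n := sampled b k n%:R; pose A' n := sampled b k (- n.+1%:R).
pose K := 4 * C * \int[lebesgue_measure]_t k t.
have Abound := norm_sampled b C lb bC k _ lk k0 l2 ksupp.
have A1 n : `|A n| <= K * (1 + n%:R ^+ 2)^-1 by exact: Abound.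
have A'1 n : `|A' n| <= K * (1 + n%:R ^+ 2)^-1.
  apply: (le_trans (Abound (- n.+1%:R))); rewrite sqrrN ler_wpM2l//.
    by rewrite !mulr_ge0// Rintegral_ge0.
  have p1 (y : R) : 0 < 1 + y ^+ 2 by have := sqr_ge0 y; lra.
  by rewrite lef_pV2 ?posrE// lerD2l ler_sqr ?nnegrE// ler_nat.
have summable (a g : nat -> R) : (forall n, `|a n| <= K * (1 + n%:R ^+ 2)^-1) ->
    (forall n, `|g n| <= 1) -> cvgn (series (fun n => a n * g n)).
  move=> ab g1; apply: normed_cvg; apply: (summable_le _ K) => n.
  by rewrite normrM (le_trans _ (ab n))// ler_piMr.
have sgn1 (m : R) : `|sg * sin m| <= 1.
  rewrite normrM; have -> : `|sg| = 1.
    by apply/eqP; rewrite -sqrp_eq1// real_normK ?num_real// sg2.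
  by rewrite mul1r sin_max.
have sgN2 : (- sg) ^+ 2 = 1 by rewrite sqrrN.
(* For nonnegative indices the power of [z] is one of its inverse, which flips [sg]. The real parts
   do not involve [sg], so both half circles are treated alike. *)
have T1 n : Gterm beta h (arc_point theta sg) n%:Z =
    (A n * cos (n%:R * theta)) +i* (A n * - (sg * sin (n%:R * theta))).
  rewrite /Gterm convE -exprnN -exprVn arc_pointV// arc_pointX//.
  by apply/eqP; rewrite eq_complex/= !mul0r subr0 addr0 mulNr !eqxx.
have T2 n : Gterm beta h (arc_point theta sg) (- n.+1%:Z) =
    (A' n * cos (n.+1%:R * theta)) +i* (A' n * (sg * sin (n.+1%:R * theta))).
  rewrite /Gterm convE opprK -exprnP arc_pointX// mulrNz.
  by apply/eqP; rewrite eq_complex/= !mul0r subr0 addr0 !eqxx.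
have re1 := summable A (fun n => cos (n%:R * theta)) A1 (fun n => cos_max _).
have re2 := summable A' (fun n => cos (n.+1%:R * theta)) A'1 (fun n => cos_max _).
have im1 := summable A (fun n => - (sg * sin (n%:R * theta))) A1
  (fun n => ltac:(by rewrite normrN)).
have im2 := summable A' (fun n => sg * sin (n.+1%:R * theta)) A'1 (fun n => sgn1 _).
have [cv1 lim1] := complex_series_cvg
  (fun n => (A n * cos (n%:R * theta)) +i* (A n * - (sg * sin (n%:R * theta)))) re1 im1.
have [cv2 lim2] := complex_series_cvg
  (fun n => (A' n * cos (n.+1%:R * theta)) +i* (A' n * (sg * sin (n.+1%:R * theta)))) re2 im2.
pose L1' := limn (series (fun n => A n * cos (n%:R * theta))).
pose L2' := limn (series (fun n => A' n * cos (n.+1%:R * theta))).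
(* The real parts of the two halves, added index by index, form the paired series whose sum is the
   positive integral of [k] against the twisted periodization. *)
have pos : 0 < L1' + L2'.
  rewrite -lim_seriesD//.
  have [lim _] := sampled_sum b C lb bC k _ lk k0 l2 ksupp theta thpi.
  have /= -> := cvg_lim (@Rhausdorff R) lim.
  exact: (sampled_sum_gt0 b C _ s2 lb bC hb k _ lk k0 l2 ksupp sigma theta).
rewrite /G /bilateral_cvg /bilateral_sum (funext T1) (funext T2).
split; first by split; [exact: cv1|exact: cv2].
move=> /(congr1 (@complex.Re R)) G0; move: pos.
rewrite /L1' /L2' -lim1 -lim2.
have ReD (x y : R[i]) : complex.Re x + complex.Re y = complex.Re (x + y).
  by case: x y => [? ?] [].
by rewrite ReD G0 ltxx.
Qed.
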